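(* Let $g,\tilde g$ be compatible metrics on a smooth manifold $M$, and let $N$ be a distinguished submanifold of $M$ with induced metrics $h,\tilde h$ (restrictions of $g,\tilde g$ to $N$). Assume $h$, $\tilde h$ and all $h_\lambda$ are non-degenerate. Let $S$ and $\tilde S$ be the second fundamental forms of $N$ in $(M,g)$ and $(M,\tilde g)$ respectively, acting on $1$-forms. Then the metrics $h$ and $\tilde h$ are compatible if and only if for every $\alpha,\beta\in(TN^\perp)^0$ and $X,Y\in TN$, $$\tilde g^*(\tilde S_X\alpha-S_X\alpha,\ \tilde S_Y\beta-S_Y\beta)=\tilde g^*(\tilde S_Y\alpha-S_Y\alpha,\ \tilde S_X\beta-S_X\beta).$$
   Context: Notation. ''Metric'' means pseudo-Riemannian metric. For a metric $g$, $g^*$ is the induced metric on $T^*M$; also $g(X)=g(X,\cdot)$ and $g^*\alpha$ is the vector field dual to the $1$-form $\alpha$. $\nabla,R$ ($\tilde\nabla,\tilde R$) are the Levi-Civita connection and curvature of $g$ ($\tilde g$), also on $T^*M$, with $R_{X,Y}=\nabla_X\nabla_Y-\nabla_Y\nabla_X-\nabla_{[X,Y]}$. Compatibility. For every constant $\lambda$ put $g_\lambda^*:=g^*+\lambda\tilde g^*$ (assumed always non-degenerate), with metric $g_\lambda$, Levi-Civita connection $\nabla^\lambda$, curvature $R^\lambda$. $g,\tilde g$ are almost compatible if $g_\lambda^*\nabla^\lambda_X\alpha=g^*\nabla_X\alpha+\lambda\tilde g^*\tilde\nabla_X\alpha$ for all vector fields $X$, $1$-forms $\alpha$ and constants $\lambda$;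 compatible if moreover $g_\lambda^*(R^\lambda_{X,Y}\alpha)=g^*(R_{X,Y}\alpha)+\lambda\tilde g^*(\tilde R_{X,Y}\alpha)$ for all $X,Y,\alpha,\lambda$. The same definitions apply to $h,\tilde h$ on $N$, with $h_\lambda^*:=h^*+\lambda\tilde h^*$. Submanifolds. $N\subset M$ is distinguished if $A(TN)\subset TN$, where $A:=\tilde g^*g:TM\to TM$ (i.e. $A(X)=\tilde g^*(g(X))$). In that case the orthogonal complements of $TN$ in $TM|_N$ with respect to $g$ and $\tilde g$ coincide and are denoted $TN^\perp$. For a subbundle $V$ of $TM|_N$, $V^0\subset T^*M|_N$ is its annihilator; thus $T^*M|_N=(TN^\perp)^0\oplus(TN)^0$. A $1$-form $\alpha$ on $N$ is identified with the section $\bar\alpha$ of $(TN^\perp)^0$ that equals $\alpha$ on $TN$ and vanishes on $TN^\perp$. For $X\in TN$ and a section $\bar\alpha$ of $(TN^\perp)^0$, $S_X\bar\alpha$ is the $(TN)^0$-component of $\nabla_X\bar\alpha$ in this decomposition, and $\tilde S_X\bar\alpha$ is the $(TN)^0$-component of $\tilde\nabla_X\bar\alpha$; $S$ and $\tilde S$ are tensorial. *)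

(* Defs.v *)
(* Conventions.  In a chart, tangent vectors and covectors are row vectors.
   With 'J the library's Jacobian, the differential of a map F at x is
   v |-> v *m 'J F x.  A metric is represented by its symmetric matrix G, so
     g(X, Y) = X *m G *m Y^T,   g(X) = X *m G,   g^* alpha = alpha *m invmx G,
   and A = g~^* g is X |-> X *m G *m invmx G~.
   A family of vectors (a subspace) is given by the row space of a matrix.   *)
From HB Require Import structures.
From mathcomp Require Import all_boot all_order all_algebra.
From mathcomp Require Import all_classical all_reals all_analysis.

Set Implicit Arguments.
Unset Strict Implicit.
Unset Printing Implicit Defensive.

Import Order.TTheory GRing.Theory Num.Theory.
Import numFieldNormedType.Exports.
Local Open Scope classical_set_scope.
Local Open Scope ring_scope.

(* Meant for open sets U. *)
Fixpoint Ck_on (k : nat) (R : realType) (n : nat) (W : normedModType R)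
    (U : set 'rV[R]_n) (f : 'rV[R]_n -> W) : Prop :=
  if k is k'.+1 then
    (forall x, U x -> differentiable f x) /\
    (forall v, Ck_on k' U (fun x => 'D_v f x))
  else forall x, U x -> {for x, continuous f}.

Definition smooth_on (R : realType) (n : nat) (W : normedModType R)
    (U : set 'rV[R]_n) (f : 'rV[R]_n -> W) : Prop :=
  forall k, Ck_on k U f.

(* The smooth structure is given by an atlas; [chart_coord i] is meaningful on
   [chart_dom i] only, and [chart_param i] is its inverse, meaningful on the
   image of [chart_dom i] only. *)
Record manifold (R : realType) (n : nat) := Manifold {
  carrier :> topologicalType;
  manifold_hausdorff : hausdorff_space carrier;
  manifold_countable : @second_countable carrier;
  chart : Type;
  chart_dom : chart -> set carrier;
  chart_coord : chart -> carrier -> 'rV[R]_n;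
  chart_param : chart -> 'rV[R]_n -> carrier;
  dom_open : forall i, open (chart_dom i);
  dom_cover : forall p, exists i, chart_dom i p;
  image_open : forall i, open (chart_coord i @` chart_dom i);
  coordK : forall i p, chart_dom i p -> chart_param i (chart_coord i p) = p;
  coord_continuous : forall i p, chart_dom i p ->
    {for p, continuous (chart_coord i)};
  param_continuous : forall i p, chart_dom i p ->
    {for chart_coord i p, continuous (chart_param i)};
  transition_smooth : forall i j,
    smooth_on (chart_coord i @` (chart_dom i `&` chart_dom j))
      (chart_coord j \o chart_param i) }.

Definition chart_image (R : realType) (n : nat) (M : manifold R n)
    (i : chart M) : set 'rV[R]_n := chart_coord i @` chart_dom i.

Definition transition (R : realType) (n : nat) (M : manifold R n)
    (i j : chart M) : 'rV[R]_n -> 'rV[R]_n := chart_coord j \o chart_param i.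

(* Pseudo-Riemannian metrics, as covariant 2-tensor fields. *)
Record metric (R : realType) (n : nat) (M : manifold R n) := Metric {
  gram :> chart M -> 'rV[R]_n -> 'M[R]_n;
  gram_smooth : forall i, smooth_on (chart_image i) (gram i);
  gram_sym : forall i x, chart_image i x -> (gram i x)^T = gram i x;
  gram_unit : forall i x, chart_image i x -> gram i x \in unitmx;
  gram_tensor : forall i j x,
    (chart_coord i @` (chart_dom i `&` chart_dom j)) x ->
    let J := 'J (transition i j) x in
    gram i x = J *m gram j (transition i j x) *m J^T }.

Section LocalGeometry.
Context {R : realType}.
Implicit Types (m n : nat).

(* Christoffel symbol Gamma^k_{ij} of the Levi-Civita connection. *)
Definition christoffel n (G : 'rV[R]_n -> 'M[R]_n) (x : 'rV[R]_n)
    (i j k : 'I_n) : R :=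
  let pd (a b c : 'I_n) : R := 'D_(delta_mx 0 a) (fun y => G y b c) x in
  2^-1 * \sum_l invmx (G x) k l * (pd i j l + pd j i l - pd l i j).

(* The covector  dx^j |-> Gamma^k_{ij} v^i a_k. *)
Definition gamma n (G : 'rV[R]_n -> 'M[R]_n) (x v a : 'rV[R]_n) : 'rV[R]_n :=
  \row_j \sum_i \sum_k christoffel G x i j k * v 0 i * a 0 k.

(* Levi-Civita connection on 1-forms. *)
Definition nabla n (G : 'rV[R]_n -> 'M[R]_n) (X a : 'rV[R]_n -> 'rV[R]_n) :
    'rV[R]_n -> 'rV[R]_n :=
  fun x => 'D_(X x) a x - gamma G x (X x) (a x).

Definition bracket n (X Y : 'rV[R]_n -> 'rV[R]_n) : 'rV[R]_n -> 'rV[R]_n :=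
  fun x => 'D_(X x) Y x - 'D_(Y x) X x.

Definition curvature n (G : 'rV[R]_n -> 'M[R]_n)
    (X Y a : 'rV[R]_n -> 'rV[R]_n) : 'rV[R]_n -> 'rV[R]_n :=
  fun x => nabla G X (nabla G Y a) x - nabla G Y (nabla G X a) x
           - nabla G (bracket X Y) a x.

(* [copencil] is g_lambda^*, and [pencil] is the metric g_lambda. *)
Definition copencil n (G Gt : 'rV[R]_n -> 'M[R]_n) (lambda : R) :
    'rV[R]_n -> 'M[R]_n :=
  fun x => invmx (G x) + lambda *: invmx (Gt x).

Definition pencil n (G Gt : 'rV[R]_n -> 'M[R]_n) (lambda : R) :
    'rV[R]_n -> 'M[R]_n :=
  fun x => invmx (copencil G Gt lambda x).

(* Induced connection on covectors along a map F, in the direction u. *)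
Definition nabla_along m n (G : 'rV[R]_m -> 'M[R]_m)
    (F : 'rV[R]_n -> 'rV[R]_m) (u : 'rV[R]_n) (a : 'rV[R]_n -> 'rV[R]_m)
    (y : 'rV[R]_n) : 'rV[R]_m :=
  'D_u a y - gamma G (F y) (u *m 'J F y) (a y).

Definition orthogonal_space m n (G : 'M[R]_m) (V : 'M[R]_(n, m)) : 'M[R]_m :=
  kermx (G *m V^T).

Definition annihilator m n (V : 'M[R]_(n, m)) : 'M[R]_m := kermx V^T.

(* (TN)^0 and (TN^perp)^0 at y, for the immersion F. *)
Definition TN0 m n (F : 'rV[R]_n -> 'rV[R]_m) (y : 'rV[R]_n) : 'M[R]_m :=
  annihilator ('J F y).

Definition TNperp0 m n (G : 'rV[R]_m -> 'M[R]_m) (F : 'rV[R]_n -> 'rV[R]_m)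
    (y : 'rV[R]_n) : 'M[R]_m :=
  annihilator (orthogonal_space (G (F y)) ('J F y)).

(* S_u a: the (TN)^0-component of nabla_u a in (TN^perp)^0 (+) (TN)^0. *)
Definition second_form m n (G : 'rV[R]_m -> 'M[R]_m)
    (F : 'rV[R]_n -> 'rV[R]_m) (u : 'rV[R]_n) (a : 'rV[R]_n -> 'rV[R]_m)
    (y : 'rV[R]_n) : 'rV[R]_m :=
  nabla_along G F u a y *m proj_mx (TN0 F y) (TNperp0 G F y).

Definition cometric m (G : 'M[R]_m) (a b : 'rV[R]_m) : R :=
  (a *m invmx G *m b^T) 0 0.

End LocalGeometry.

Definition pencil_nondegenerate (R : realType) (n : nat) (M : manifold R n)
    (g gt : metric M) : Prop :=
  forall (lambda : R) (i : chart M) x, chart_image i x ->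
    copencil (g i) (gt i) lambda x \in unitmx.

(* Connections and curvatures being local operators, vector fields and 1-forms
   range over smooth ones on arbitrary open subsets U of chart domains
   (U being read in the chart). *)
Definition almost_compatible (R : realType) (n : nat) (M : manifold R n)
    (g gt : metric M) : Prop :=
  forall (i : chart M) (U : set 'rV[R]_n), open U -> U `<=` chart_image i ->
  forall X a : 'rV[R]_n -> 'rV[R]_n, smooth_on U X -> smooth_on U a ->
  forall (lambda : R) x, U x ->
    nabla (pencil (g i) (gt i) lambda) X a x
      *m copencil (g i) (gt i) lambda x
    = nabla (g i) X a x *m invmx (g i x)
      + lambda *: (nabla (gt i) X a x *m invmx (gt i x)).

Definition compatible (R : realType) (n : nat) (M : manifold R n)
    (g gt : metric M) : Prop :=
  almost_compatible g gt /\
  forall (i : chart M) (U : set 'rV[R]_n), open U -> U `<=` chart_image i ->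
  forall X Y a : 'rV[R]_n -> 'rV[R]_n,
    smooth_on U X -> smooth_on U Y -> smooth_on U a ->
  forall (lambda : R) x, U x ->
    curvature (pencil (g i) (gt i) lambda) X Y a x
      *m copencil (g i) (gt i) lambda x
    = curvature (g i) X Y a x *m invmx (g i x)
      + lambda *: (curvature (gt i) X Y a x *m invmx (gt i x)).

Section Submanifold.
Context {R : realType} {m n : nat} {M : manifold R m} {N : manifold R n}.
Implicit Types (f : N -> M) (i : chart M) (j : chart N).

Definition local_dom f j i : set 'rV[R]_n :=
  chart_coord j @` (chart_dom j `&` f @^-1` chart_dom i).

Definition local_map f j i : 'rV[R]_n -> 'rV[R]_m :=
  chart_coord i \o f \o chart_param j.

(* N, with its inclusion f, is a (possibly not embedded) submanifold of M. *)
Definition submanifold f : Prop :=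
  [/\ injective f, continuous f,
      forall j i, smooth_on (local_dom f j i) (local_map f j i) &
      forall j i y, local_dom f j i y -> row_free ('J (local_map f j i) y)].

Definition distinguished f (g gt : metric M) : Prop :=
  forall j i y, local_dom f j i y ->
    let J := 'J (local_map f j i) y in
    let x := local_map f j i y in
    (J *m (g i x *m invmx (gt i x)) <= J)%MS.

Definition induced_metric f (g : metric M) (h : metric N) : Prop :=
  forall j i y, local_dom f j i y ->
    let J := 'J (local_map f j i) y in
    h j y = J *m g i (local_map f j i y) *m J^T.

(* Section of (TN^perp)^0 over U; U is read in the chart j of N, the values
   in the chart i of M. *)
Definition tangential_form f (g : metric M) j i (U : set 'rV[R]_n)
    (a : 'rV[R]_n -> 'rV[R]_m) : Prop :=
  smooth_on U a /\
  forall y, U y -> (a y <= TNperp0 (g i) (local_map f j i) y)%MS.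

Definition second_form_diff f (g gt : metric M) j i (u : 'rV[R]_n)
    (a : 'rV[R]_n -> 'rV[R]_m) (y : 'rV[R]_n) : 'rV[R]_m :=
  second_form (gt i) (local_map f j i) u a y
  - second_form (g i) (local_map f j i) u a y.

End Submanifold.

(* Main.v *)
From HB Require Import structures.
Require Import Defs.
From mathcomp Require Import all_boot all_order all_algebra.
From mathcomp Require Import all_classical all_reals all_analysis.
From mathcomp Require Import ring lra.
Set Implicit Arguments.
Unset Strict Implicit.
Unset Printing Implicit Defensive.
Import Order.TTheory GRing.Theory Num.Theory.
Import numFieldNormedType.Exports.
Local Open Scope classical_set_scope.
Local Open Scope ring_scope.

(** Compatibility is first reduced to algebra at a point.  Write G, G~ for the
    Gram matrices of the two metrics, K = G^-1, K~ = G~^-1, G_l for the inverse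
    of K_l = K + l K~, and T = nabla~ - nabla, a tensor acting on 1-forms.
    Since a connection preserves its metric, for a constant covector b
      <R^l(X,Y) a, b>_l = X <nabla^l_Y a, b>_l - <nabla^l_Y a, nabla^l_X b>_l
                          - (X <-> Y) - <nabla^l_[X,Y] a, b>_l,
    where < , >_l is the pairing by K_l.  When the metrics are almost compatible,
    K_l nabla^l is affine in l, and so is every term on the right except the
    products <nabla^l_Y a, nabla^l_X b>_l.  What remains of the curvature
    condition is therefore algebraic ([curvature_defect]):
      l (T_X b . K G_l K~ . T_Y a - T_Y b . K G_l K~ . T_X a) = 0.
    Because all nabla^l are torsion-free, the factor K G_l can be moved from T_X b
    into the vector X ([diffconn_pencil_ratio_swap]), and being invertible it
    disappears.  So compatible means almost compatible and
      K~(T_X a, T_Y b) = K~(T_Y a, T_X b)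
    ([diffconn_symmetricP], [compatibleP]).

    On N, the splitting of covectors into (TN^perp)^0 and (TN)^0 is the same for
    all metrics of the pencil, and the metric h_l is induced by g_l
    ([pencil_restrict]).  The Levi-Civita connection of an induced metric is the
    ambient one followed by restriction to TN, up to a second derivative of the
    immersion in which the metric enters only through that splitting
    ([gamma_restrict]).  Hence almost compatibility passes to N
    ([almost_compatible_restrict]); the tensor T of N is the tangential part of T
    ([diffconn_restrict]); and S~ - S is the normal part ([second_form_restrict]).
    The two parts are orthogonal for g~, so the identity displayed above, which
    holds on M, is the sum of the same identity on N and of the identity for
    S~ - S: either of them implies the other ([diffconn_symmetric_restrict]). *)

(** * Derivatives of matrix-valued functions *)

Section MatrixCalculus.
Context {R : realType} {V : normedModType R}.

Lemma near_differentiable {W : normedModType R} (f g : V -> W) (x : V) :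
  (\near x, f x = g x) -> differentiable f x -> differentiable g x.
Proof.
move=> fg df; have fgx : f x = g x := nbhs_singleton fg.
have h0 : g \o shift x = cst (g x) + 'd f x +o_ 0 id.
  apply/eqaddoP => _/posnumP[e].
  have /eqaddoP /(_ e%:num (gt0 _)) := diff_locally df.
  have : \forall h \near 0, f (h + x) = g (h + x).
    by move: fg; rewrite (near_shift 0 x) subr0.
  apply: filterS2 => h /= e1.
  by rewrite -![(_ - _ : _ -> _) _]/(_ - _) -![(_ + _ : _ -> _) _]/(_ + _) /= /cst fgx e1.
apply/diff_locallyP.
have dE : 'd g x = 'd f x :> (V -> W) by apply/diff_unique => //; exact: diff_continuous.
by rewrite dE; split; [exact: diff_continuous|].
Qed.

Lemma differentiable_mxP {p q} (f : V -> 'M[R]_(p, q)) x :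
  differentiable f x <-> forall i j, differentiable (fun y => f y i j) x.
Proof.
split=> [df i j|df].
  exact: (differentiable_comp df (differentiable_coord (f x) i j)).
have -> : f = \sum_i \sum_j (fun y => f y i j *: delta_mx i j).
  apply/funext => y; rewrite fct_sumE {1}[f y]matrix_sum_delta.
  by apply: eq_bigr => i _; rewrite fct_sumE.
by apply: differentiable_sum => i; apply: differentiable_sum => j;
   apply: differentiableZl.
Qed.

Lemma derive_entry {p q} (f : V -> 'M[R]_(p, q)) x v i j :
  differentiable f x -> 'D_v f x i j = 'D_v (fun y => f y i j) x.
Proof. by move=> df; rewrite derive_mx ?mxE//; exact: diff_derivable. Qed.

Lemma differentiable_sum_fun {W : normedModType R} (I : finType)
    (f : I -> V -> W) x :
  (forall i, differentiable (f i) x) ->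
  differentiable (fun y => \sum_i f i y) x.
Proof.
move=> df; rewrite (_ : (fun _ => _) = \sum_i f i); last first.
  by apply/funext => y; rewrite fct_sumE.
elim/big_ind: _ => [|g h dg dh|i _]; last exact: df.
  exact: differentiable_cst.
exact: differentiableD.
Qed.

Lemma derive_sum_fun {W : normedModType R} (I : finType)
    (f : I -> V -> W) x v :
  (forall i, differentiable (f i) x) ->
  'D_v (fun y => \sum_i f i y) x = \sum_i 'D_v (f i) x.
Proof.
move=> df; rewrite (_ : (fun _ => _) = \sum_i f i); last first.
  by apply/funext => y; rewrite fct_sumE.
suff [] : differentiable (\sum_i f i) x /\
   'D_v (\sum_i f i) x = \sum_i 'D_v (f i) x by [].
elim/big_rec2: _ => [|i g h _ [dh <-]].
  by split; [exact: differentiable_cst|exact: derive_cst].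
split; first exact: differentiableD.
by rewrite deriveD//; exact: diff_derivable.
Qed.

Lemma differentiable_mulmx {p q r} (f : V -> 'M[R]_(p, q))
    (g : V -> 'M[R]_(q, r)) x :
  differentiable f x -> differentiable g x ->
  differentiable (fun y => f y *m g y) x.
Proof.
move=> /differentiable_mxP df /differentiable_mxP dg.
apply/differentiable_mxP => i j.
under eq_fun do rewrite mxE.
by apply: differentiable_sum_fun => k; exact: differentiableM.
Qed.

Lemma derive_mulmx {p q r} (f : V -> 'M[R]_(p, q)) (g : V -> 'M[R]_(q, r)) x v :
  differentiable f x -> differentiable g x ->
  'D_v (fun y => f y *m g y) x = 'D_v f x *m g x + f x *m 'D_v g x.
Proof.
move=> df dg; apply/matrixP => i j.
rewrite derive_entry; last exact: differentiable_mulmx.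
under eq_fun do rewrite mxE.
have dfe k := (differentiable_mxP f x).1 df i k.
have dge k := (differentiable_mxP g x).1 dg k j.
rewrite derive_sum_fun; last by move=> k; exact: differentiableM.
rewrite !mxE -big_split; apply: eq_bigr => k _ /=.
rewrite [LHS](deriveM (diff_derivable (dfe k)) (diff_derivable (dge k))).
rewrite (derive_entry _ _ _ df) (derive_entry _ _ _ dg) addrC.
by congr (_ + _); exact: mulrC.
Qed.

Lemma differentiable_trmx {p q} (f : V -> 'M[R]_(p, q)) x :
  differentiable f x -> differentiable (fun y => (f y)^T) x.
Proof.
move=> /differentiable_mxP df; apply/differentiable_mxP => i j.
by under eq_fun do rewrite mxE.
Qed.

Lemma derive_trmx {p q} (f : V -> 'M[R]_(p, q)) x v :
  differentiable f x -> 'D_v (fun y => (f y)^T) x = ('D_v f x)^T.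
Proof.
move=> df; apply/matrixP => i j; rewrite derive_entry; last exact: differentiable_trmx.
by rewrite mxE derive_entry//; under eq_fun do rewrite mxE.
Qed.

Lemma differentiable_prod_fun (I : Type) (s : seq I) (P : pred I) (f : I -> V -> R) x :
  (forall i, differentiable (f i) x) ->
  differentiable (fun y => \prod_(i <- s | P i) f i y) x.
Proof.
move=> df; elim: s => [|i s IH].
  by under eq_fun do rewrite big_nil; exact: differentiable_cst.
under eq_fun do rewrite big_cons.
by case: (P i) => //; exact: differentiableM.
Qed.

Lemma differentiable_det {p} (f : V -> 'M[R]_p) x :
  differentiable f x -> differentiable (fun y => \det (f y)) x.
Proof.
move=> /differentiable_mxP df; apply: differentiable_sum_fun => s.
by apply: differentiableM; [exact: differentiable_cst|exact: differentiable_prod_fun].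
Qed.

Lemma differentiable_invmx {p} (f : V -> 'M[R]_p) x :
  differentiable f x -> (\near x, f x \in unitmx) ->
  differentiable (fun y => invmx (f y)) x.
Proof.
move=> df fu; apply: (@near_differentiable _ (fun y => (\det (f y))^-1 *: \adj (f y))).
  by apply: filterS fu => y fu; rewrite /invmx fu.
have dfe := (differentiable_mxP f x).1 df.
apply/differentiable_mxP => i j; under eq_fun do rewrite !mxE.
apply: differentiableM.
  apply: differentiableV; first exact: differentiable_det.
  by have := nbhs_singleton fu; rewrite unitmxE unitfE.
apply: differentiableM; first exact: differentiable_cst.
apply: differentiable_det; apply/differentiable_mxP => k l.
by under eq_fun do rewrite !mxE.
Qed.

Lemma derive_invmx {p} (f : V -> 'M[R]_p) x v :
  differentiable f x -> (\near x, f x \in unitmx) ->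
  'D_v (fun y => invmx (f y)) x = - (invmx (f x) *m 'D_v f x *m invmx (f x)).
Proof.
move=> df fu; have fxu : f x \in unitmx := nbhs_singleton fu.
have di := differentiable_invmx df fu.
have : 'D_v (fun y => f y *m invmx (f y)) x = 0.
  rewrite -[RHS](derive_cst (1%:M : 'M[R]_p) x v); apply: near_eq_derive.
  by apply: filterS fu => y fu; rewrite mulmxV.
rewrite derive_mulmx// => /eqP; rewrite addrC addr_eq0 => /eqP e.
by rewrite -mulmxA -mulmxN -e mulKmx.
Qed.

Lemma derive_mulmxl {p q r} (A : 'M[R]_(p, q)) (g : V -> 'M[R]_(q, r)) x v :
  differentiable g x -> 'D_v (fun y => A *m g y) x = A *m 'D_v g x.
Proof.
move=> dg; rewrite (derive_mulmx (f := cst A)) ?derive_cst ?mul0mx ?add0r//.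
Qed.

End MatrixCalculus.

(** * Closure properties of smooth functions *)

Section Smoothness.
Context {R : realType} {n : nat}.
Implicit Types (U : set 'rV[R]_n) (k : nat).

Lemma open_near {T : topologicalType} (U : set T) (P : T -> Prop) x :
  open U -> U x -> (forall y, U y -> P y) -> \near x, P x.
Proof. by move=> oU Ux UP; apply: filterS UP _; exact: open_nbhs_nbhs. Qed.

Lemma Ck_ext {W : normedModType R} k U (f g : 'rV[R]_n -> W) :
  open U -> (forall x, U x -> f x = g x) -> Ck_on k U f -> Ck_on k U g.
Proof.
move=> oU; elim: k f g => [|k IH] f g fg /= cf.
  move=> x Ux; change (g @ x --> g x); rewrite -(fg x Ux).
  exact: cvg_trans (near_eq_cvg (open_near oU Ux fg)) (cf x Ux).
case: cf => df cdf; split=> [x Ux|v].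
  exact: (near_differentiable (open_near oU Ux fg) (df x Ux)).
apply: IH (cdf v) => x Ux; apply: near_eq_derive.
exact: (open_near oU Ux fg).
Qed.

Lemma Ck_sub {W : normedModType R} k U U' (f : 'rV[R]_n -> W) :
  U `<=` U' -> Ck_on k U' f -> Ck_on k U f.
Proof.
move=> UU'; elim: k f => [|k IH] f /= cf; first by move=> x /UU'; exact: cf.
by case: cf => df cdf; split=> [x /UU'|v]; [exact: df|exact: IH].
Qed.

Lemma Ck_pred {W : normedModType R} k U (f : 'rV[R]_n -> W) :
  Ck_on k.+1 U f -> Ck_on k U f.
Proof.
elim: k f => [|k IH] f /= [df cdf].
  by move=> x Ux; exact: differentiable_continuous (df x Ux).
by split=> // v; exact: IH (cdf v).
Qed.

Lemma Ck_cst {W : normedModType R} k U (w : W) : Ck_on k U (cst w : 'rV[R]_n -> W).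
Proof.
elim: k w => [|k IH] w /=; first by move=> x _; exact: (@cst_continuous _ _ w x).
split=> [x _|v]; first exact: differentiable_cst.
rewrite (_ : (fun x => _) = cst 0); first exact: IH.
by apply/funext => x; rewrite derive_cst.
Qed.

Lemma smooth_cst {W : normedModType R} U (w : W) :
  smooth_on U (cst w : 'rV[R]_n -> W).
Proof. by move=> k; exact: Ck_cst. Qed.

Lemma CkD {W : normedModType R} k U (f g : 'rV[R]_n -> W) : open U ->
  Ck_on k U f -> Ck_on k U g -> Ck_on k U (fun x => f x + g x).
Proof.
move=> oU; elim: k f g => [|k IH] f g /=.
  by move=> cf cg x Ux; exact: (cvgD (cf x Ux) (cg x Ux)).
move=> [df cdf] [dg cdg]; split=> [x Ux|v].
  exact: differentiableD (df x Ux) (dg x Ux).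
apply: Ck_ext oU _ (IH _ _ (cdf v) (cdg v)) => x Ux.
by rewrite deriveD//; apply: diff_derivable; [exact: df|exact: dg].
Qed.

Lemma Ck_sum {W : normedModType R} (I : finType) k U (f : I -> 'rV[R]_n -> W) :
  open U -> (forall i, Ck_on k U (f i)) -> Ck_on k U (fun x => \sum_i f i x).
Proof.
move=> oU cf; rewrite (_ : (fun x => _) = \sum_i f i); last first.
  by apply/funext => y; rewrite fct_sumE.
elim/big_ind: _ => [|g h cg ch|i _]; last exact: cf.
  exact: Ck_cst.
exact: CkD.
Qed.

Lemma CkM k U (f g : 'rV[R]_n -> R) : open U ->
  Ck_on k U f -> Ck_on k U g -> Ck_on k U (fun x => f x * g x).
Proof.
move=> oU; elim: k f g => [|k IH] f g cf cg.
  by move=> x Ux; exact: (cvgM (cf x Ux) (cg x Ux)).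
have [df cdf] := cf; have [dg cdg] := cg; split=> [x Ux|v].
  exact: differentiableM (df x Ux) (dg x Ux).
have := CkD oU (IH _ _ (Ck_pred cf) (cdg v)) (IH _ _ (Ck_pred cg) (cdf v)).
apply: Ck_ext oU _ => x Ux.
by rewrite [RHS](deriveM (diff_derivable (df _ Ux)) (diff_derivable (dg _ Ux))).
Qed.

Lemma CkZl {W : normedModType R} k U (c : 'rV[R]_n -> R) (w : W) : open U ->
  Ck_on k U c -> Ck_on k U (fun x => c x *: w).
Proof.
move=> oU; elim: k c => [|k IH] c.
  by move=> cc x Ux; exact: (cvgZr_tmp (cc x Ux)).
move=> [dc cdc]; split=> [x Ux|v].
  exact: differentiableZl (dc x Ux).
apply: Ck_ext oU _ (IH _ (cdc v)) => x Ux.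
have dcx := dc x Ux.
by rewrite (deriveE v dcx) (deriveE v (differentiableZl w dcx)) diffZl.
Qed.

Lemma Ck_mxP {p q} k U (f : 'rV[R]_n -> 'M[R]_(p, q)) : open U ->
  Ck_on k U f <-> forall i j, Ck_on k U (fun x => f x i j).
Proof.
move=> oU; split=> [cf i j|cf].
  elim: k f cf => [|k IH] f.
    move=> cf x Ux.
    exact: continuous_comp (cf x Ux) (@coord_continuous _ _ _ i j (f x)).
  move=> [df cdf]; split=> [x Ux|v].
    by have /differentiable_mxP := df x Ux; exact.
  by apply: Ck_ext oU _ (IH _ (cdf v)) => x Ux; exact: derive_entry (df x Ux).
have : Ck_on k U (fun x => \sum_i \sum_j f x i j *: (delta_mx i j : 'M[R]_(p, q))).
  by apply: Ck_sum => // i; apply: Ck_sum => // j; exact: CkZl.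
by apply: Ck_ext oU _ => x _; rewrite -matrix_sum_delta.
Qed.

Lemma Ck_mulmx {p q r} k U (f : 'rV[R]_n -> 'M[R]_(p, q))
    (g : 'rV[R]_n -> 'M[R]_(q, r)) : open U ->
  Ck_on k U f -> Ck_on k U g -> Ck_on k U (fun x => f x *m g x).
Proof.
move=> oU /(Ck_mxP _ _ oU) cf /(Ck_mxP _ _ oU) cg; apply/(Ck_mxP _ _ oU) => i j.
under eq_fun do rewrite mxE.
by apply: Ck_sum => // l; exact: CkM.
Qed.

End Smoothness.

Lemma derive_delta_sum {R : realType} {m} {W : normedModType R}
    (G : 'rV[R]_m -> W) x v : differentiable G x ->
  'D_v G x = \sum_k v 0 k *: 'D_(delta_mx 0 k) G x.
Proof.
move=> dG; rewrite deriveE// {1}(row_sum_delta v) linear_sum.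
by apply: eq_bigr => k _; rewrite linearZ /= deriveE.
Qed.

Lemma derive_comp {R : realType} {V V' W : normedModType R} (G : V' -> W)
    (F : V -> V') y v : differentiable F y -> differentiable G (F y) ->
  'D_v (G \o F) y = 'D_('D_v F y) G (F y).
Proof.
move=> dF dG; rewrite (deriveE _ (differentiable_comp dF dG)).
by rewrite (diff_comp dF dG) (deriveE _ dG) (deriveE _ dF).
Qed.

(** By the chain rule the derivative of the composite is again a sum of products
    of derivatives of F and composites of derivatives of G, so the induction is
    on the order, for all G at once. *)
Lemma Ck_comp {R : realType} {m n p q} k (U : set 'rV[R]_n) (U' : set 'rV[R]_m)
    (F : 'rV[R]_n -> 'rV[R]_m) (G : 'rV[R]_m -> 'M[R]_(p, q)) :
  open U -> open U' -> (forall y, U y -> U' (F y)) ->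
  Ck_on k U F -> Ck_on k U' G -> Ck_on k U (G \o F).
Proof.
move=> oU oU' FU cF /(Ck_mxP _ _ oU') cG; apply/(Ck_mxP _ _ oU) => i j.
move: (cG i j); rewrite (_ : (fun y => (G \o F) y i j) = (fun x => G x i j) \o F)//.
move: (fun x => G x i j) => {cG} {}G cG.
elim: k G cF cG => [|k IH] G cF cG.
  move=> y Uy; apply: continuous_comp; first exact: cF.
  exact: cG (FU _ Uy).
have [dF cdF] := cF; have [dG cdG] := cG; split=> [y Uy|v].
  exact: differentiable_comp (dF y Uy) (dG _ (FU _ Uy)).
have : Ck_on k U (fun y => \sum_l 'D_v F y 0 l * 'D_(delta_mx 0 l) G (F y)).
  apply: Ck_sum => // l; apply: CkM => //.
    by have /(Ck_mxP _ _ oU) := cdF v; exact.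
  exact: IH (Ck_pred cF) (cdG _).
apply: Ck_ext oU _ => y Uy.
have dGy := dG _ (FU _ Uy).
by rewrite (derive_comp _ (dF y Uy) dGy) (derive_delta_sum _ dGy).
Qed.

(** * Symmetry of second derivatives *)

Section SecondDerivatives.
Context {R : realType} {V : normedModType R}.
Implicit Types (f : V -> R) (u v x : V).

Lemma is_derive_line {W : normedModType R} (f : V -> W) x u (s : R) :
  differentiable f (s *: u + x) ->
  is_derive s 1 (fun r : R => f (r *: u + x)) ('D_u f (s *: u + x)).
Proof.
move=> /(@diff_derivable _ _ _ _ _ u) df.
have E : (fun h : R => h^-1 *: (((fun r => f (r *: u + x)) \o shift s) (h *: (1 : R))
           - f (s *: u + x))) =
    (fun h => h^-1 *: ((f \o shift (s *: u + x)) (h *: u) - f (s *: u + x))).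
  by apply/funext => h /=; rewrite scalerDl [h *: 1]mulr1 addrA.
by split; rewrite /derivable /derive E.
Qed.

(** By the mean value theorem applied to s |-> f (s u + t v + x) - f (s u + x),
    the second difference is t times an increment of D_u f in the direction t v,
    which the differential of D_u f at x computes up to o(t). *)
Lemma second_difference f x u v (e : R) :
  (\near x, differentiable f x) -> differentiable ('D_u f) x -> 0 < e ->
  \forall t \near 0^'+,
    `|f (t *: u + (t *: v + x)) - f (t *: u + x) - f (t *: v + x) + f x
      - t ^+ 2 * 'D_v ('D_u f) x| <= e * t ^+ 2.
Proof.
move=> fn du e0; rewrite deriveE//; set L := 'd ('D_u f) x.
(* t C bounds the sum of the distances to x of the two points at which D_u f is
   compared with its affine approximation. *)
set C := `|u| + `|v| + `|u| + 1.
have [nu nv] : 0 <= `|u| /\ 0 <= `|v| by [].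
have C0 : 0 < C by rewrite /C; lra.
have uC : `|u| <= C by rewrite /C; lra.
have uvC : `|u| + `|v| <= C by rewrite /C; lra.
have /eqaddoP /(_ (e / C) (divr_gt0 e0 C0)) := diff_locally du.
move=> /nbhs_normP[d1 /= d10 H1].
move: fn; rewrite (near_shift 0 x) subr0 => /nbhs_normP[d2 /= d20 H2].
near=> t.
have t0 : 0 < t by near: t; exact: nbhs_right_gt.
have tC d : 0 < d -> t < d / C -> forall s, 0 <= s <= t ->
    `|s *: u| < d /\ `|s *: u + t *: v| < d.
  move=> d0; rewrite ltr_pdivlMr// => td s /andP[s0 st].
  have su : `|s *: u| <= t * `|u| by rewrite normrZ ger0_norm// ler_wpM2r.
  split; apply: le_lt_trans td.
    by rewrite (le_trans su)// ler_pM2l.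
  rewrite (le_trans (ler_normD _ _))// (normrZ t) (gtr0_norm t0).
  by rewrite (le_trans (lerD su (lexx _)))// -mulrDr ler_pM2l.
have t1 : t < d1 / C by near: t; apply: nbhs_right_lt; exact: divr_gt0.
have t2 : t < d2 / C by near: t; apply: nbhs_right_lt; exact: divr_gt0.
pose k (s : R) := f (s *: u + (t *: v + x)) - f (s *: u + x).
pose dk (s : R) := 'D_u f (s *: u + (t *: v + x)) - 'D_u f (s *: u + x).
have kd s : 0 <= s <= t -> is_derive s 1 k (dk s).
  move=> /(tC _ d20 t2)[h1 h2]; apply: is_deriveB; apply: is_derive_line.
    rewrite addrA; apply: (H2 (s *: u + t *: v)).
    by rewrite /= sub0r normrN.
  by apply: (H2 (s *: u)); rewrite /= sub0r normrN.
have [||c /andP[/= c0 ct]] := @MVT _ k dk 0 t t0.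
  by move=> s /andP[/= s0 st]; apply: kd; rewrite !ltW.
  by apply: derivable_within_continuous => s; rewrite in_itv /= => /kd[].
have -> : k t - k 0 = f (t *: u + (t *: v + x)) - f (t *: u + x)
    - f (t *: v + x) + f x.
  by rewrite /k !scale0r !add0r opprB addrA addrAC.
rewrite subr0 => ->.
have cb : 0 <= c <= t by rewrite !ltW.
have [h2 h1] := tC _ d10 t1 c cb.
have /= H12 := H1 (c *: u); have /= H11 := H1 (c *: u + t *: v).
have {H12} := H12; rewrite sub0r normrN => /(_ h2) e2.
have {H11} := H11; rewrite sub0r normrN => /(_ h1) e1.
have {e1} : `|'D_u f (c *: u + t *: v + x) - ('D_u f x + L (c *: u + t *: v))|
    <= e / C * `|c *: u + t *: v| := e1.
have {e2} : `|'D_u f (c *: u + x) - ('D_u f x + L (c *: u))| <= e / C * `|c *: u| := e2.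
have -> : dk c * t - t ^+ 2 * L v =
    t * ('D_u f (c *: u + t *: v + x) - ('D_u f x + L (c *: u + t *: v))
         - ('D_u f (c *: u + x) - ('D_u f x + L (c *: u)))).
  rewrite /dk (linearD L) (linearZ_LR L _ v) addrA /= /GRing.scale /=.
  by ring.
set A := _ - _; set B := _ - _ => e2 e1.
rewrite normrM (gtr0_norm t0) expr2 mulrCA ler_pM2l//.
apply: (le_trans (ler_normB _ _)); apply: (le_trans (lerD e1 e2)).
have -> : e * t = e / C * (t * C) by rewrite mulrA mulrAC divfK// gt_eqF.
rewrite -mulrDr ler_pM2l ?divr_gt0//.
have cu : `|c *: u| <= t * `|u|.
  by rewrite normrZ ler_wpM2r// ger0_norm; case/andP: cb.
apply: (le_trans (lerD (ler_normD _ _) cu)).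
rewrite (normrZ t) (gtr0_norm t0) (le_trans (lerD (lerD cu (lexx _)) (lexx _)))//.
by rewrite -!mulrDr ler_pM2l// /C lerDl.
Unshelve. all: by end_near. Qed.

(** The second difference is symmetric in u and v, and its quotient by t^2 has
    both second derivatives as limit. *)
Lemma derive_comm f x u v :
  (\near x, differentiable f x) ->
  differentiable ('D_u f) x -> differentiable ('D_v f) x ->
  'D_v ('D_u f) x = 'D_u ('D_v f) x.
Proof.
move=> fn du dv; apply/eqP; rewrite -subr_eq0 -normr_le0.
apply/ler_addgt0Pl => e e0; rewrite addr0.
have e20 : 0 < e / 2 by rewrite divr_gt0.
have H1 := second_difference v fn du e20.
have H2 := second_difference u fn dv e20.
move: ('D_v ('D_u f) x) ('D_u ('D_v f) x) H1 H2 => {du dv fn} a b H1 H2.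
have [t [t0 [h1 h2]]] :=
  filter_ex (filterI (nbhs_right_gt (0 : R)) (filterI H1 H2)).
move: h2 h1; rewrite (addrCA (t *: v)) (addrAC (f (t *: u + (t *: v + x)))).
set F := f _ - _ - _ + _ => h2 h1; have := le_trans (ler_normB _ _) (lerD h2 h1).
have -> : F - t ^+ 2 * b - (F - t ^+ 2 * a) = t ^+ 2 * (a - b) by ring.
have t20 : 0 < t ^+ 2 by rewrite exprn_gt0.
by rewrite normrM (gtr0_norm t20) -mulrDl -splitr mulrC ler_pM2r.
Qed.

End SecondDerivatives.

Lemma derive_comm_mx {R : realType} {n p q} (U : set 'rV[R]_n)
    (F : 'rV[R]_n -> 'M[R]_(p, q)) x u v :
  open U -> Ck_on 2 U F -> U x -> 'D_v ('D_u F) x = 'D_u ('D_v F) x.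
Proof.
move=> oU [dF cdF] Ux; apply/matrixP => i j.
have dD w : differentiable ('D_w F) x by case: (cdF w) => + _; exact.
have E w : \near x, 'D_w F x i j = 'D_w (fun z => F z i j) x.
  by apply: (open_near oU Ux) => z Uz; exact: derive_entry (dF z Uz).
have dDe w : differentiable ('D_w (fun z => F z i j)) x.
  apply: near_differentiable (E w) _.
  by have /differentiable_mxP := dD w; exact.
have step w w' : 'D_w' ('D_w F) x i j = 'D_w' ('D_w (fun z => F z i j)) x :=
  etrans (derive_entry w' i j (dD w)) (near_eq_derive w' (E w)).
have Fn : \near x, differentiable (fun z => F z i j) x.
  apply: (open_near oU Ux) => z Uz.
  by have /differentiable_mxP := dF z Uz; exact.
exact: etrans (step u v) (etrans (derive_comm Fn (dDe u) (dDe v)) (esym (step v u))).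
Qed.

(** * The standard pairing of row vectors *)

HB.lock Definition dot {R : realType} {n : nat} (a b : 'rV[R]_n) : R :=
  (a *m b^T) 0 0.

Section Dot.
Context {R : realType}.
Implicit Types n : nat.

Lemma dotC n (a b : 'rV[R]_n) : dot a b = dot b a.
Proof. by rewrite dot.unlock -{1}(trmxK a) -trmx_mul mxE. Qed.

Lemma dotDl n (a b c : 'rV[R]_n) : dot (a + b) c = dot a c + dot b c.
Proof. by rewrite dot.unlock mulmxDl mxE. Qed.

Lemma dotNl n (a c : 'rV[R]_n) : dot (- a) c = - dot a c.
Proof. by rewrite dot.unlock mulNmx mxE. Qed.

Lemma dotZl n k (a c : 'rV[R]_n) : dot (k *: a) c = k * dot a c.
Proof. by rewrite dot.unlock -scalemxAl mxE. Qed.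

Lemma dotDr n (a b c : 'rV[R]_n) : dot c (a + b) = dot c a + dot c b.
Proof. by rewrite !(dotC c) dotDl. Qed.

Lemma dotNr n (a c : 'rV[R]_n) : dot c (- a) = - dot c a.
Proof. by rewrite !(dotC c) dotNl. Qed.

Lemma dotZr n k (a c : 'rV[R]_n) : dot c (k *: a) = k * dot c a.
Proof. by rewrite !(dotC c) dotZl. Qed.

Definition dotE := (dotDl, dotDr, dotNl, dotNr, dotZl, dotZr).

Lemma dot_mulmx m n (A : 'M[R]_(m, n)) a b : dot (a *m A) b = dot a (b *m A^T).
Proof. by rewrite dot.unlock trmx_mul trmxK mulmxA. Qed.

Lemma dot_mulmx_sym n (A : 'M[R]_n) a b : A^T = A -> dot (a *m A) b = dot a (b *m A).
Proof. by move=> sA; rewrite dot_mulmx sA. Qed.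

Lemma dot_ext n (a b : 'rV[R]_n) : (forall w, dot a w = dot b w) -> a = b.
Proof.
move=> ab; apply/rowP => j; have := ab (delta_mx 0 j).
by rewrite dot.unlock trmx_delta -!colE !mxE.
Qed.

Lemma dot_sum n (A : 'M[R]_n) u w :
  dot (u *m A) w = \sum_i \sum_j u 0 i * w 0 j * A i j.
Proof.
rewrite dot.unlock mxE exchange_big; apply: eq_bigr => j _ /=.
by rewrite !mxE mulr_suml; apply: eq_bigr => i _; rewrite mulrAC.
Qed.

Lemma dot_sum_derive n (G : 'rV[R]_n -> 'M[R]_n) x u v w : differentiable G x ->
  dot (v *m 'D_u G x) w = \sum_i \sum_j \sum_l u 0 i * v 0 j * w 0 l *
    'D_(delta_mx 0 i) (fun y => G y j l) x.
Proof.
move=> dG; rewrite (derive_delta_sum _ dG) mulmx_sumr dot.unlock mulmx_suml summxE.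
apply: eq_bigr => i _.
rewrite -scalemxAr -scalemxAl mxE.
have := dot_sum ('D_(delta_mx 0 i) G x) v w; rewrite dot.unlock => ->.
rewrite mulr_sumr.
apply: eq_bigr => j _; rewrite mulr_sumr; apply: eq_bigr => l _.
by rewrite derive_entry// !mulrA.
Qed.

End Dot.

(** * The Levi-Civita connection of a metric in a chart *)

Ltac dot_ring :=
  repeat match goal with |- context [dot ?a ?b] => generalize (dot a b) end;
  intros; ring.

Section LeviCivita.
Context {R : realType} {n : nat}.
Implicit Types (G : 'rV[R]_n -> 'M[R]_n) (x u v w a b : 'rV[R]_n).

(** The Koszul formula for the Christoffel symbols of the first kind; D u stands
    for the derivative of the metric in the direction u. *)
Definition koszul (D : 'rV[R]_n -> 'M[R]_n) u v w : R :=
  2^-1 * (dot (v *m D u) w + dot (u *m D v) w - dot (u *m D w) v).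

Lemma koszulC D u v w :
  (forall z, (D z)^T = D z) -> koszul D u v w = koszul D v u w.
Proof.
move=> sD; rewrite /koszul (dot_mulmx_sym u v (sD w)) (dotC u).
by rewrite (addrC (dot (v *m D u) w)).
Qed.

Lemma koszul_metric D u v w : (forall z, (D z)^T = D z) ->
  koszul D u v w + koszul D u w v = dot (v *m D u) w.
Proof.
move=> sD; rewrite /koszul (dot_mulmx_sym w v (sD u)) (dotC w); by field.
Qed.

Lemma gamma_koszul G x v a w : differentiable G x ->
  dot (gamma G x v a) w = koszul (fun u => 'D_u G x) v w (a *m invmx (G x)).
Proof.
move=> dG; set b := a *m _.
pose pd (i j l : 'I_n) : R := 'D_(delta_mx 0 i) (fun y => G y j l) x.
pose S (p q r : 'rV[R]_n) : R :=
  \sum_i \sum_j \sum_l p 0 i * q 0 j * r 0 l * pd i j l.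
have -> : koszul (fun u => 'D_u G x) v w b = 2^-1 * (S v w b + S w v b - S b v w).
  congr (_ * (_ + _ - _)); first exact: (dot_sum_derive v w b dG).
    exact: (dot_sum_derive w v b dG).
  exact: (dot_sum_derive b v w dG).
rewrite /S.
have -> : \sum_i \sum_j \sum_l w 0 i * v 0 j * b 0 l * pd i j l =
          \sum_i \sum_j \sum_l v 0 i * w 0 j * b 0 l * pd j i l.
  rewrite exchange_big; apply: eq_bigr => i _; apply: eq_bigr => j _.
  by apply: eq_bigr => l _; rewrite (mulrC (w 0 j)).
have -> : \sum_i \sum_j \sum_l b 0 i * v 0 j * w 0 l * pd i j l =
          \sum_i \sum_j \sum_l v 0 i * w 0 j * b 0 l * pd l i j.
  rewrite exchange_big; apply: eq_bigr => i _; rewrite exchange_big /=.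
  by apply: eq_bigr => j _; apply: eq_bigr => l _; ring.
rewrite -big_split -sumrB mulr_sumr dot.unlock mxE.
under eq_bigr do rewrite !mxE mulr_suml.
rewrite exchange_big; apply: eq_bigr => i _ /=.
rewrite -big_split -sumrB mulr_sumr; apply: eq_bigr => j _ /=.
rewrite -big_split -sumrB mulr_sumr /=.
transitivity (\sum_l \sum_k a 0 k * invmx (G x) k l *
    (2^-1 * (v 0 i * w 0 j) * (pd i j l + pd j i l - pd l i j))).
  rewrite exchange_big mulr_suml; apply: eq_bigr => k _ /=.
  rewrite /christoffel mulr_sumr !mulr_suml; apply: eq_bigr => l _ /=.
  by rewrite /pd; ring.
apply: eq_bigr => l _; rewrite -mulr_suml.
by rewrite [b 0 l]mxE; ring.
Qed.

(** What the first-order calculus at x needs of a metric; symmetry and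
    invertibility are required nearby because they get differentiated. *)
Definition metric_at G x : Prop :=
  [/\ differentiable G x, \near x, (G x)^T = G x & \near x, G x \in unitmx].

Lemma derive_sym G x u : metric_at G x -> ('D_u G x)^T = 'D_u G x.
Proof.
by move=> [dG sG _]; rewrite -derive_trmx//; exact: near_eq_derive.
Qed.

Lemma invmx_sym p (A : 'M[R]_p) : A^T = A -> (invmx A)^T = invmx A.
Proof. by move=> sA; rewrite trmx_inv sA. Qed.

(** The connection is torsion-free. *)
Lemma gamma_sym G x v a w : metric_at G x ->
  dot (gamma G x v a) w = dot (gamma G x w a) v.
Proof.
move=> mG; have [dG _ _] := mG; rewrite (gamma_koszul v a w dG).
rewrite (gamma_koszul w a v dG) koszulC// => z; exact: derive_sym.
Qed.

(** The connection preserves the metric on covectors. *)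
Lemma gamma_metric G x v a b : metric_at G x ->
  dot (gamma G x v a *m invmx (G x)) b + dot (gamma G x v b *m invmx (G x)) a
  = - dot (a *m 'D_v (fun y => invmx (G y)) x) b.
Proof.
move=> mG; have [dG sG uG] := mG.
have sD z : ('D_z G x)^T = 'D_z G x by exact: derive_sym.
have sK : (invmx (G x))^T = invmx (G x) by apply: invmx_sym; exact: nbhs_singleton sG.
rewrite (dot_mulmx_sym (gamma G x v a) b sK) (gamma_koszul v a _ dG).
rewrite (dot_mulmx_sym (gamma G x v b) a sK) (gamma_koszul v b _ dG).
rewrite (koszul_metric _ _ _ sD) (derive_invmx v dG uG) mulmxN dotNl opprK !mulmxA.
by rewrite [RHS](dot_mulmx_sym _ _ sK) dotC (dot_mulmx_sym _ _ (sD v)).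
Qed.

Lemma pencil_metric_at G Gt l x : metric_at G x -> metric_at Gt x ->
  (\near x, copencil G Gt l x \in unitmx) -> metric_at (pencil G Gt l) x.
Proof.
move=> [dG sG uG] [dGt sGt uGt] uK; split.
  apply: differentiable_invmx uK; apply: differentiableD.
    exact: differentiable_invmx.
  by apply: differentiableZ; exact: differentiable_invmx.
  apply: filterS2 sG sGt => y sG sGt; apply: invmx_sym.
  by rewrite /copencil linearD linearZ /= !trmx_inv sG sGt.
by apply: filterS uK => y; rewrite unitmx_inv.
Qed.

(** The Leibniz rule for the pairing of p with the constant covector b, whose
    covariant derivative is - gamma(X, b). *)
Lemma nabla_pairing G X p x b : metric_at G x -> differentiable p x ->
  dot (nabla G X p x *m invmx (G x)) b =
  dot ('D_(X x) (fun y => p y *m invmx (G y)) x) b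
  + dot (gamma G x (X x) b *m invmx (G x)) (p x).
Proof.
move=> mG dp; have [dG sG uG] := mG.
rewrite /nabla derive_mulmx//; last exact: differentiable_invmx.
have := gamma_metric (X x) (p x) b mG.
by rewrite mulmxDl mulNmx !dotE => e; lra.
Qed.

(** * Pencils of metrics and the difference tensor *)

(** The tensor nabla~ - nabla; gamma enters nabla with a minus sign. *)
Definition diffconn G Gt x v a : 'rV[R]_n := gamma G x v a - gamma Gt x v a.

(** Almost compatibility for constant vector fields and 1-forms: the terms that
    differentiate the 1-form agree on both sides for every pair of metrics. *)
Definition almost_compatible_at G Gt x : Prop := forall l v a,
  gamma (pencil G Gt l) x v a *m copencil G Gt l x
  = gamma G x v a *m invmx (G x) + l *: (gamma Gt x v a *m invmx (Gt x)).

Definition diffconn_symmetric G Gt x : Prop := forall u v a b,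
  dot (diffconn G Gt x u a *m invmx (Gt x)) (diffconn G Gt x v b)
  = dot (diffconn G Gt x v a *m invmx (Gt x)) (diffconn G Gt x u b).

Lemma copencil_sym G Gt l x : (G x)^T = G x -> (Gt x)^T = Gt x ->
  (copencil G Gt l x)^T = copencil G Gt l x.
Proof. by move=> sG sGt; rewrite /copencil linearD linearZ /= !trmx_inv sG sGt. Qed.

(** In q K + l q' K~ and p K + l p' K~ substitute l K~ = K_l - K in the first and
    K = K_l - l K~ in the second, so that the only term in which the inverse of
    K_l survives is a single product of differences. *)
Lemma pencil_identity (K Kt : 'M[R]_n) l p p' q q' : K^T = K -> Kt^T = Kt ->
  K + l *: Kt \in unitmx ->
  dot ((q *m K + l *: (q' *m Kt)) *m invmx (K + l *: Kt)) (p *m K + l *: (p' *m Kt))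
  = dot (q *m K) p + l * dot (q' *m Kt) p'
    - l * dot ((q' - q) *m (K *m invmx (K + l *: Kt) *m Kt)) (p' - p).
Proof.
set L := K + l *: Kt => sK sKt uL.
have sL : L^T = L by rewrite /L linearD linearZ /= sK sKt.
have -> : q *m K + l *: (q' *m Kt) = q' *m L - (q' - q) *m K.
  by rewrite /L mulmxDr -scalemxAr mulmxBl opprB [RHS]addrC addrA subrK.
have -> : p *m K + l *: (p' *m Kt) = p *m L + l *: ((p' - p) *m Kt).
  rewrite /L mulmxDr -scalemxAr mulmxBl scalerBr -addrA; congr (_ + _).
  by rewrite addrC subrK.
rewrite mulmxBl mulmxK// !dotDl !dotDr !dotNl !dotZr.
rewrite -!(dot_mulmx_sym _ _ sL) -!(dot_mulmx_sym _ _ sKt) (mulmxKV uL) !mulmxA.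
rewrite dotDr dotNr /L mulmxDr -scalemxAr dotDl dotZl mulmxBl dotDl dotNl.
by rewrite dotDr dotNr; ring.
Qed.

Section Pencil.
Variables (G Gt : 'rV[R]_n -> 'M[R]_n) (x : 'rV[R]_n).
Hypotheses (mG : metric_at G x) (mGt : metric_at Gt x).
Hypothesis uK : forall l, \near x, copencil G Gt l x \in unitmx.

Local Notation T := (diffconn G Gt x).
Local Notation K := (invmx (G x)).
Local Notation Kt := (invmx (Gt x)).

Let sG : (G x)^T = G x. Proof. by case: mG => _ /nbhs_singleton. Qed.
Let sGt : (Gt x)^T = Gt x. Proof. by case: mGt => _ /nbhs_singleton. Qed.
Let sK : K^T = K. Proof. exact: invmx_sym. Qed.
Let sKt : Kt^T = Kt. Proof. exact: invmx_sym. Qed.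
Let uKx l : copencil G Gt l x \in unitmx. Proof. exact: nbhs_singleton (uK l). Qed.
Let sP l : (pencil G Gt l x)^T = pencil G Gt l x.
Proof. by apply: invmx_sym; exact: copencil_sym. Qed.

(** The endomorphism of covectors that relates g to g_l. *)
Definition pencil_ratio l : 'M[R]_n := K *m pencil G Gt l x.

Lemma diffconn_sym v w a : dot (T v a) w = dot (T w a) v.
Proof. by rewrite !dotDl !dotNl (gamma_sym v a w mG) (gamma_sym v a w mGt). Qed.

(** Almost compatibility says gamma_l = (gamma K + l gamma~ K~) G_l; subtracting
    gamma~ = gamma~ (K + l K~) G_l removes the terms in K~. *)
Lemma diffconn_pencil_ratio l v a : almost_compatible_at G Gt x ->
  T v a *m pencil_ratio l = gamma (pencil G Gt l) x v a - gamma Gt x v a.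
Proof.
move=> ac; rewrite /pencil_ratio.
have := congr1 (mulmxr (pencil G Gt l x)) (ac l v a); rewrite /= mulmxK// => ->.
rewrite mulmxDl -scalemxAl.
have e : gamma Gt x v a = (gamma Gt x v a *m K + l *: (gamma Gt x v a *m Kt))
    *m pencil G Gt l x.
  by rewrite scalemxAr -mulmxDr; exact: esym (mulmxK (uKx l) _).
rewrite /diffconn; move: e.
move: (gamma G x v a) (gamma Gt x v a) (pencil G Gt l x) => c ct P e.
rewrite [X in _ = _ - X]e [in RHS]mulmxDl -scalemxAl opprD addrACA subrr addr0.
by rewrite mulmxA !mulmxBl.
Qed.

(** A difference of torsion-free connections is symmetric in its two vector
    arguments; this holds for nabla~ - nabla^l and for nabla~ - nabla. *)
Lemma diffconn_pencil_ratio_swap l v a : almost_compatible_at G Gt x ->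
  T v a *m pencil_ratio l = T (v *m (pencil_ratio l)^T) a.
Proof.
move=> ac; apply: dot_ext => w; rewrite [RHS]diffconn_sym -dot_mulmx.
have mP := pencil_metric_at mG mGt (uK l).
rewrite !diffconn_pencil_ratio// !dotDl !dotNl.
by rewrite (gamma_sym v a w mP) (gamma_sym v a w mGt).
Qed.

Lemma pencil_ratio_sym l : (pencil_ratio l *m Kt)^T = pencil_ratio l *m Kt.
Proof.
have e : pencil_ratio l *m Kt = Kt - l *: (Kt *m pencil G Gt l x *m Kt).
  rewrite /pencil_ratio -{2}[Kt]mul1mx -(mulmxV (uKx l)) /copencil !mulmxDl.
  by rewrite -!scalemxAl addrK.
by rewrite e linearB linearZ /= !trmx_mul sP sKt mulmxA.
Qed.

Lemma unitmx_pencil l : pencil G Gt l x \in unitmx.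
Proof. by rewrite unitmx_inv. Qed.

Lemma pencil_ratio_unit l : pencil_ratio l \in unitmx.
Proof.
case: mG => _ _ /nbhs_singleton uG.
by rewrite unitmx_mul unitmx_inv uG unitmx_pencil.
Qed.

(** Moving pencil_ratio l into the vector argument turns one identity into the
    other; the direct implication uses l = 1 and the invertibility of the ratio. *)
Lemma diffconn_symmetricP : almost_compatible_at G Gt x ->
  (forall l u v a b,
     l * dot (T u b *m (pencil_ratio l *m Kt)) (T v a)
     = l * dot (T v b *m (pencil_ratio l *m Kt)) (T u a)) <->
  diffconn_symmetric G Gt x.
Proof.
move=> ac; split=> [E u v a b|Q l u v a b].
  (* The vector chosen here becomes u once the ratio has moved into it. *)
  have := E 1 (u *m (invmx (pencil_ratio 1))^T) v b a; rewrite !mul1r => {}E.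
  have uE : u *m (invmx (pencil_ratio 1))^T *m (pencil_ratio 1)^T = u.
    by rewrite -mulmxA -trmx_mul mulmxV ?pencil_ratio_unit// trmx1 mulmx1.
  rewrite -[in RHS]pencil_ratio_sym trmx_mul sKt in E.
  rewrite (mulmxA _ (pencil_ratio 1)) (mulmxA _ Kt) in E.
  rewrite (diffconn_pencil_ratio_swap _ _ _ ac) uE in E.
  by rewrite E [LHS]dot_mulmx trmxK (diffconn_pencil_ratio_swap _ _ _ ac) uE.
congr (_ * _); rewrite -[in RHS]pencil_ratio_sym trmx_mul sKt.
rewrite (mulmxA _ (pencil_ratio l)) (mulmxA _ Kt).
rewrite (diffconn_pencil_ratio_swap _ _ _ ac) Q -(diffconn_pencil_ratio_swap _ _ _ ac).
by rewrite [RHS]dot_mulmx trmxK.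
Qed.

End Pencil.

(** * The curvature condition *)

Section CurvatureDefect.
Variables (G Gt : 'rV[R]_n -> 'M[R]_n) (x : 'rV[R]_n) (l : R).
Hypotheses (mG : metric_at G x) (mGt : metric_at Gt x).
Hypothesis uK : \near x, copencil G Gt l x \in unitmx.
Hypothesis ac : \near x, almost_compatible_at G Gt x.

Local Notation T := (diffconn G Gt x).
Local Notation Gl := (pencil G Gt l).

Lemma nabla_pencil (X a : 'rV[R]_n -> 'rV[R]_n) y : almost_compatible_at G Gt y ->
  nabla Gl X a y *m copencil G Gt l y =
  nabla G X a y *m invmx (G y) + l *: (nabla Gt X a y *m invmx (Gt y)).
Proof.
move=> /(_ l (X y) (a y)); rewrite /nabla; set cl := gamma (pencil _ _ _) _ _ _.
set c := gamma G _ _ _; set ct := gamma Gt _ _ _.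
move: cl c ct ('D_(X y) a y) => cl c ct d acy.
rewrite !mulmxBl acy {1}/copencil mulmxDr -scalemxAr.
by rewrite scalerBr opprD addrACA.
Qed.

(** The derivatives of the products p K, with p = nabla_Y a, are affine in l by
    almost compatibility; [pencil_identity] evaluates the remaining terms. *)
Lemma nabla2_defect (X Y a : 'rV[R]_n -> 'rV[R]_n) b :
  differentiable (nabla G Y a) x -> differentiable (nabla Gt Y a) x ->
  dot (nabla Gl X (nabla Gl Y a) x *m copencil G Gt l x
       - (nabla G X (nabla G Y a) x *m invmx (G x)
          + l *: (nabla Gt X (nabla Gt Y a) x *m invmx (Gt x)))) b
  = l * dot (T (X x) b *m (pencil_ratio G Gt x l *m invmx (Gt x))) (T (Y x) (a x)).
Proof.
move=> dp dpt.
have [dG sG uG] := mG; have [dGt sGt uGt] := mGt.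
have mP := pencil_metric_at mG mGt uK.
have uKx : copencil G Gt l x \in unitmx := nbhs_singleton uK.
pose p := nabla G Y a; pose pt := nabla Gt Y a; pose pl := nabla Gl Y a.
have dpK : differentiable (fun y => p y *m invmx (G y)) x.
  by apply: differentiable_mulmx dp _; exact: differentiable_invmx.
have dpKt : differentiable (fun y => pt y *m invmx (Gt y)) x.
  by apply: differentiable_mulmx dpt _; exact: differentiable_invmx.
have dsum : differentiable (fun y => p y *m invmx (G y) + l *: (pt y *m invmx (Gt y))) x.
  by apply: differentiableD dpK _; exact: differentiableZ.
have plE : \near x, p x *m invmx (G x) + l *: (pt x *m invmx (Gt x))
                    = pl x *m invmx (Gl x).
  by apply: filterS ac => y acy; rewrite invmxK -nabla_pencil.
have dpl : differentiable pl x.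
  have [dP _ uP] := mP.
  apply: (@near_differentiable _ _ _ (fun y => (p y *m invmx (G y) +
      l *: (pt y *m invmx (Gt y))) *m Gl y)).
    by apply: filterS2 plE uP => y -> uP; rewrite mulmxKV.
  exact: differentiable_mulmx.
pose dK := 'D_(X x) (fun y => p y *m invmx (G y)) x.
pose dKt := 'D_(X x) (fun y => pt y *m invmx (Gt y)) x.
have := nabla_pairing X b mP dpl; rewrite invmxK.
have -> : 'D_(X x) (fun y => pl y *m invmx (Gl y)) x = dK + l *: dKt.
  rewrite -(near_eq_derive _ plE) -deriveZ; last exact: diff_derivable.
  rewrite deriveD//; first exact: diff_derivable.
  by apply: derivableZ; exact: diff_derivable.
have E2 : dot (nabla G X p x *m invmx (G x)) b
  = dot dK b + dot (gamma G x (X x) b *m invmx (G x)) (p x) := nabla_pairing X b mG dp.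
have E3 : dot (nabla Gt X pt x *m invmx (Gt x)) b
  = dot dKt b + dot (gamma Gt x (X x) b *m invmx (Gt x)) (pt x) := nabla_pairing X b mGt dpt.
have acx : almost_compatible_at G Gt x := nbhs_singleton ac.
have sK := invmx_sym (nbhs_singleton sG); have sKt := invmx_sym (nbhs_singleton sGt).
have plx : pl x = (p x *m invmx (G x) + l *: (pt x *m invmx (Gt x)))
    *m invmx (copencil G Gt l x).
  by rewrite -nabla_pencil// mulmxK.
have sKl : (invmx (copencil G Gt l x))^T = invmx (copencil G Gt l x).
  by apply: invmx_sym; exact: copencil_sym (nbhs_singleton sG) (nbhs_singleton sGt).
have dT : pt x - p x = T (Y x) (a x).
  by rewrite /p /pt /nabla /diffconn opprB addrC addrA subrK.
have bT : gamma Gt x (X x) b - gamma G x (X x) b = - T (X x) b by rewrite opprB.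
have E4 := pencil_identity (p x) (pt x) (gamma G x (X x) b) (gamma Gt x (X x) b)
  sK sKt uKx.
have WE : invmx (G x) *m invmx (invmx (G x) + l *: invmx (Gt x)) *m invmx (Gt x)
    = pencil_ratio G Gt x l *m invmx (Gt x) by [].
pose S := dot (T (X x) b *m (pencil_ratio G Gt x l *m invmx (Gt x))) (T (Y x) (a x)).
rewrite dT bT WE mulNmx dotNl -/S in E4.
rewrite (acx l) plx -(dot_mulmx_sym _ _ sKl) [X in _ = _ + X]E4 => E1.
move: E1 E2 E3; rewrite -/p -/pt -/pl.
generalize (nabla Gl X pl x *m copencil G Gt l x) (nabla G X p x *m invmx (G x))
  (nabla Gt X pt x *m invmx (Gt x)) => A1 A2 A3 E1 E2 E3.
rewrite (dotDl A1) dotNl (dotDl A2) dotZl E1 E2 E3 dotDl dotZl -/S.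
by dot_ring.
Qed.

Lemma curvature_defect (X Y a : 'rV[R]_n -> 'rV[R]_n) b :
  differentiable (nabla G X a) x -> differentiable (nabla Gt X a) x ->
  differentiable (nabla G Y a) x -> differentiable (nabla Gt Y a) x ->
  dot (curvature Gl X Y a x *m copencil G Gt l x
       - (curvature G X Y a x *m invmx (G x)
          + l *: (curvature Gt X Y a x *m invmx (Gt x)))) b
  = l * dot (T (X x) b *m (pencil_ratio G Gt x l *m invmx (Gt x))) (T (Y x) (a x))
    - l * dot (T (Y x) b *m (pencil_ratio G Gt x l *m invmx (Gt x))) (T (X x) (a x)).
Proof.
move=> dXa dXta dYa dYta.
have uKx : copencil G Gt l x \in unitmx := nbhs_singleton uK.
have := nabla2_defect X b dYa dYta; have := nabla2_defect Y b dXa dXta.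
have := nabla_pencil (bracket X Y) a (nbhs_singleton ac).
rewrite /curvature.
generalize (nabla Gl (bracket X Y) a x) (nabla Gl X (nabla Gl Y a) x)
  (nabla Gl Y (nabla Gl X a) x) (nabla G (bracket X Y) a x)
  (nabla G X (nabla G Y a) x) (nabla G Y (nabla G X a) x)
  (nabla Gt (bracket X Y) a x) (nabla Gt X (nabla Gt Y a) x)
  (nabla Gt Y (nabla Gt X a) x) => pl pxl pyl p px py pt pxt pyt E <- <-.
have dot3 (u v w : 'rV[R]_n) (A : 'M[R]_n) :
    dot ((u - v - w) *m A) b = dot (u *m A) b - dot (v *m A) b - dot (w *m A) b.
  by rewrite !mulmxBl !dotE.
by rewrite !(dotDl, dotNl, dotZl) !dot3 E dotDl dotZl; dot_ring.
Qed.

End CurvatureDefect.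

End LeviCivita.

(** * Compatibility as a pointwise condition *)

Section SmoothMetric.
Context {R : realType} {n : nat}.
Variables (U : set 'rV[R]_n) (oU : open U).

Lemma differentiable_gamma (H : 'rV[R]_n -> 'M[R]_n) (X a : 'rV[R]_n -> 'rV[R]_n) x :
  U x -> smooth_on U H -> (forall y, U y -> H y \in unitmx) ->
  differentiable X x -> differentiable a x ->
  differentiable (fun y => gamma H y (X y) (a y)) x.
Proof.
move=> Ux sH uH /differentiable_mxP dX /differentiable_mxP da.
have [dH cdH] := sH 2%N.
have dDH u : differentiable ('D_u H) x by case: (cdH u) => + _; exact.
have dDe u i j : differentiable ('D_u (fun y => H y i j)) x.
  have E : \near x, 'D_u H x i j = 'D_u (fun y => H y i j) x.
    by apply: (open_near oU Ux) => y Uy; exact: derive_entry (dH y Uy).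
  by apply: near_differentiable E _; have /differentiable_mxP := dDH u; exact.
have dK k l : differentiable (fun y => invmx (H y) k l) x.
  have : differentiable (fun y => invmx (H y)) x.
    by apply: differentiable_invmx; [exact: dH|exact: open_near oU Ux uH].
  by move=> /differentiable_mxP; exact.
apply/differentiable_mxP => i j; under eq_fun do rewrite mxE.
apply: differentiable_sum_fun => k; apply: differentiable_sum_fun => l.
apply: differentiableM; last exact: da.
apply: differentiableM; last exact: dX.
apply: differentiableM; first exact: differentiable_cst.
apply: differentiable_sum_fun => p; apply: differentiableM; first exact: dK.
by apply: differentiableB (dDe _ _ _); apply: differentiableD.
Qed.

Lemma differentiable_nabla (H : 'rV[R]_n -> 'M[R]_n) (X a : 'rV[R]_n -> 'rV[R]_n) x :
  U x -> smooth_on U H -> (forall y, U y -> H y \in unitmx) ->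
  smooth_on U X -> smooth_on U a -> differentiable (nabla H X a) x.
Proof.
move=> Ux sH uH sX sa.
have [dX _] := sX 1%N; have [da cda] := sa 2%N.
apply: differentiableB; last first.
  exact: differentiable_gamma (dX x Ux) (da x Ux).
have E : \near x, \sum_k X x 0 k *: 'D_(delta_mx 0 k) a x = 'D_(X x) a x.
  by apply: (open_near oU Ux) => y Uy; rewrite -derive_delta_sum//; exact: da.
apply: near_differentiable E _; apply: differentiable_sum_fun => k.
have /differentiable_mxP dXx := dX x Ux.
have [/(_ x Ux) /differentiable_mxP dak _] := cda (delta_mx 0 k).
apply/differentiable_mxP => i j; under eq_fun do rewrite mxE.
exact: differentiableM.
Qed.

Lemma metric_at_smooth (H : 'rV[R]_n -> 'M[R]_n) x : U x -> smooth_on U H ->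
  (forall y, U y -> (H y)^T = H y) -> (forall y, U y -> H y \in unitmx) ->
  metric_at H x.
Proof.
move=> Ux sH tH uH; split; [|exact: open_near oU Ux tH|exact: open_near oU Ux uH].
by have [+ _] := sH 1%N; exact.
Qed.

End SmoothMetric.

Lemma nabla_cst {R : realType} {n} (G : 'rV[R]_n -> 'M[R]_n) v a x :
  nabla G (cst v) (cst a) x = - gamma G x v a.
Proof. by rewrite /nabla derive_cst sub0r. Qed.

Lemma open_chart_image {R : realType} {n} (N : manifold R n) (i : chart N) :
  open (chart_image i).
Proof. exact: (@image_open R n N i). Qed.
Arguments open_chart_image {R n N} i.

Section CompatibleMetrics.
Context {R : realType} {n : nat} {N : manifold R n} (h ht : metric N).
Hypothesis h_pencil : pencil_nondegenerate h ht.

Lemma metric_at_gram (k : metric N) i x : chart_image i x -> metric_at (k i) x.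
Proof.
move=> ix; apply: (metric_at_smooth (open_chart_image i) ix).
exact: gram_smooth. exact: gram_sym. exact: gram_unit.
Qed.

Lemma copencil_near i x l : chart_image i x ->
  \near x, copencil (h i) (ht i) l x \in unitmx.
Proof.
move=> ix; apply: (open_near (open_chart_image i) ix) => y iy; exact: h_pencil.
Qed.

(** Only the Christoffel symbols matter, and constant fields detect them. *)
Lemma almost_compatibleP : almost_compatible h ht <->
  forall i x, chart_image i x -> almost_compatible_at (h i) (ht i) x.
Proof.
split=> [ac i x ix l v a|ac i U oU Ui X a sX sa l x Ux].
  have := ac i _ (open_chart_image i) (@subset_refl _ _) (cst v) (cst a)
    (smooth_cst _ _) (smooth_cst _ _) l x ix.
  rewrite (nabla_cst (pencil _ _ _)) (nabla_cst (h i)) (nabla_cst (ht i)).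
  generalize (gamma (pencil (h i) (ht i) l) x v a) (gamma (h i) x v a)
    (gamma (ht i) x v a) => cl c ct.
  rewrite !mulNmx scalerN => /(congr1 -%R).
  by rewrite opprD !opprK.
exact: nabla_pencil (ac i x (Ui x Ux)).
Qed.

Lemma compatibleP : compatible h ht <->
  forall i x, chart_image i x ->
    almost_compatible_at (h i) (ht i) x /\ diffconn_symmetric (h i) (ht i) x.
Proof.
have nab i U (k : metric N) (X a : 'rV[R]_n -> 'rV[R]_n) x : open U ->
    U `<=` chart_image i -> smooth_on U X -> smooth_on U a -> U x ->
    differentiable (nabla (k i) X a) x.
  move=> oU Ui sX sa Ux; apply: (differentiable_nabla oU Ux) => //.
    by move=> j; apply: Ck_sub Ui _; exact: gram_smooth.
  by move=> y /Ui; exact: gram_unit.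
split=> [[ac cc]|E].
  have {}ac := almost_compatibleP.1 ac.
  move=> i x ix; split; first exact: ac.
  have oi : open (chart_image i) := open_chart_image i.
  have acn : \near x, almost_compatible_at (h i) (ht i) x := open_near oi ix (ac i).
  apply: (diffconn_symmetricP (metric_at_gram h ix) (metric_at_gram ht ix)
    (fun l => copencil_near l ix) (ac i x ix)).1 => l u v a b.
  have := cc i _ oi (@subset_refl _ _) (cst u) (cst v) (cst a)
    (smooth_cst _ _) (smooth_cst _ _) (smooth_cst _ _) l x ix.
  have nabx (k : metric N) w : differentiable (nabla (k i) (cst w) (cst a)) x.
    exact: nab oi (@subset_refl _ _) (smooth_cst _ _) (smooth_cst _ _) ix.
  have := curvature_defect (metric_at_gram h ix) (metric_at_gram ht ix)
    (copencil_near l ix) acn b (nabx h u) (nabx ht u) (nabx h v) (nabx ht v).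
  move=> + /eqP; rewrite -subr_eq0 => + /eqP e; rewrite e.
  by rewrite dotC dot.unlock trmx0 mulmx0 mxE => /esym/eqP; rewrite subr_eq0 => /eqP.
have ac i x (ix : chart_image i x) := (E i x ix).1.
split; first exact/almost_compatibleP.
move=> i U oU Ui X Y a sX sY sa l x Ux; have ix := Ui x Ux.
have acn : \near x, almost_compatible_at (h i) (ht i) x :=
  open_near (open_chart_image i) ix (ac i).
have nabx (k : metric N) Z : smooth_on U Z -> differentiable (nabla (k i) Z a) x.
  by move=> sZ; exact: nab oU Ui sZ sa Ux.
apply/eqP; rewrite -subr_eq0; apply/eqP; apply: dot_ext => b.
have -> := curvature_defect (metric_at_gram h ix) (metric_at_gram ht ix)
    (copencil_near l ix) acn b (nabx h _ sX) (nabx ht _ sX) (nabx h _ sY) (nabx ht _ sY).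
have -> := (diffconn_symmetricP (metric_at_gram h ix) (metric_at_gram ht ix)
    (fun l => copencil_near l ix) (ac i x ix)).2 (E i x ix).2 l (X x) (Y x) (a x) b.
by rewrite subrr dot.unlock mul0mx mxE.
Qed.

End CompatibleMetrics.

(** * Induced metrics *)

(** The case of interest is h = J g J^T, with B u the derivative of J in the
    direction u.  The terms containing B cancel in pairs, except two equal ones,
    because the second derivative of the immersion is symmetric. *)
Lemma koszul_restrict {R : realType} {m n} (D : 'rV[R]_m -> 'M[R]_m)
    (B : 'rV[R]_n -> 'M[R]_(n, m)) (g : 'M[R]_m) (J : 'M[R]_(n, m)) u v w :
  g^T = g -> (forall u v, v *m B u = u *m B v) ->
  koszul (fun u => B u *m g *m J^T + J *m D (u *m J) *m J^T + J *m g *m (B u)^T) u v w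
  = koszul D (u *m J) (v *m J) (w *m J) + dot (v *m B u *m g) (w *m J).
Proof.
move=> sg sB; rewrite /koszul.
have E p q r : dot (p *m (B q *m g *m J^T + J *m D (q *m J) *m J^T + J *m g *m (B q)^T)) r
    = dot (p *m B q *m g) (r *m J) + dot (p *m J *m D (q *m J)) (r *m J)
      + dot (p *m J *m g) (r *m B q).
  by rewrite !mulmxDr !dotDl !mulmxA !(dot_mulmx _ _ r) !trmxK.
rewrite !E (sB v u) (sB w u) (sB w v).
rewrite (dot_mulmx_sym (v *m J) _ sg) (dotC (v *m J)).
move: (dot _ _) (dot _ _) (dot _ _) (dot _ _) (dot _ _) (dot _ _) => *.
by field.
Qed.

(** * The splitting of covectors along a submanifold *)

(** The inclusion of T*N into T*M with image (TN^perp)^0; h is the Gram matrix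
    J g J^T of the induced metric. *)
HB.lock Definition tangential_lift {R : realType} {m n} (g : 'M[R]_m) (h : 'M[R]_n)
    (J : 'M[R]_(n, m)) : 'M[R]_(n, m) := invmx h *m J *m g.

Section TangentialLift.
Context {R : realType} {m n : nat}.
Implicit Types (J : 'M[R]_(n, m)) (g gt : 'M[R]_m) (h ht : 'M[R]_n).

(** If A is stable on TN, with matrix D there, then J g = D J g~ and h = D h~, and
    D cancels. *)
Lemma tangential_lift_eq g gt h ht J : gt \in unitmx ->
  h \in unitmx -> ht \in unitmx ->
  h = J *m g *m J^T -> ht = J *m gt *m J^T -> (J *m (g *m invmx gt) <= J)%MS ->
  tangential_lift gt ht J = tangential_lift g h J.
Proof.
move=> ugt uh uht hE htE /submxP[D DE].
have JgE : J *m g = D *m J *m gt by rewrite -DE -!mulmxA mulVmx// mulmx1.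
have hD : h = D *m ht by rewrite hE htE JgE !mulmxA.
rewrite tangential_lift.unlock -!mulmxA JgE -[LHS](mulKmx uh) {2}hD.
by rewrite -!mulmxA (mulKVmx uht).
Qed.

Variables (g : 'M[R]_m) (h : 'M[R]_n) (J : 'M[R]_(n, m)).
Hypotheses (sg : g^T = g) (ug : g \in unitmx) (uh : h \in unitmx).
Hypothesis hE : h = J *m g *m J^T.

Local Notation P := (tangential_lift g h J).

Let sh : h^T = h. Proof. by rewrite hE !trmx_mul trmxK sg mulmxA. Qed.

Lemma tangential_liftK : P *m J^T = 1%:M.
Proof. by rewrite tangential_lift.unlock -!mulmxA (mulmxA J) -hE mulVmx. Qed.

Lemma tangential_liftV : P *m invmx g = invmx h *m J.
Proof. by rewrite tangential_lift.unlock mulmxK. Qed.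

Lemma tangential_liftV_tr : invmx g *m P^T = J^T *m invmx h.
Proof.
by rewrite -(invmx_sym sg) -trmx_mul tangential_liftV trmx_mul (invmx_sym sh).
Qed.

Lemma tangential_lift_cometric : P *m invmx g *m P^T = invmx h.
Proof.
rewrite tangential_liftV -mulmxA; have /(congr1 trmx) := tangential_liftK.
by rewrite trmx_mul trmxK trmx1 => ->; rewrite mulmx1.
Qed.

(** (TN^perp)^0 and (TN)^0 are orthogonal, and J^T P is the projection onto the
    former along the latter. *)
Lemma dot_orthogonal_decomposition w w' :
  dot (w *m invmx g) w' = dot (w *m J^T *m invmx h) (w' *m J^T)
    + dot (w *m (1%:M - J^T *m P) *m invmx g) (w' *m (1%:M - J^T *m P)).
Proof.
set Q := 1%:M - _.
have QE (z : 'rV_m) : z = z *m J^T *m P + z *m Q.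
  by rewrite /Q mulmxBr mulmx1 mulmxA [RHS]addrC subrK.
have Q0 : Q *m invmx g *m P^T = 0.
  rewrite /Q !mulmxBl mul1mx tangential_liftV_tr -!mulmxA (mulmxA P) .
  by rewrite tangential_lift_cometric subrr.
have c0 (z z' : 'rV_m) : dot (z *m Q *m invmx g) (z' *m J^T *m P) = 0.
  rewrite dotC dot_mulmx -(mulmxA z) -(mulmxA z) Q0.
  by rewrite mulmx0 dot.unlock trmx0 mulmx0 mxE.
have c1 (z z' : 'rV_m) : dot (z *m J^T *m P *m invmx g) (z' *m Q) = 0.
  by rewrite (dot_mulmx_sym _ _ (invmx_sym sg)) dotC c0.
rewrite {1}(QE w) {1}(QE w') mulmxDl dotDl !dotDr c0 c1 add0r addr0.
congr (_ + _).
by rewrite [LHS]dotC dot_mulmx -!(mulmxA (w *m J^T)) tangential_lift_cometric dotC.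
Qed.

Lemma annihilatorP p (b : 'M[R]_(p, m)) (V : 'M[R]_(n, m)) :
  reflect (b *m V^T = 0) (b <= annihilator V)%MS.
Proof. exact: sub_kermxP. Qed.

Lemma orthogonal_annihilatorP p (b : 'M[R]_(p, m)) :
  (b <= annihilator (orthogonal_space g J))%MS <-> b = b *m J^T *m P.
Proof.
split=> [/sub_kermxP b0|->]; last first.
  apply/sub_kermxP; suff P0 : P *m (orthogonal_space g J)^T = 0.
    by rewrite -(mulmxA (b *m J^T)) P0 mulmx0.
  rewrite tangential_lift.unlock -!mulmxA -{1}sg -trmx_mul -{1}(trmxK J) -trmx_mul -mulmxA.
  by rewrite mulmx_ker trmx0 mulmx0.
(* The g-orthogonal projection onto TN^perp, acting on vectors. *)
pose Q := 1%:M - g *m J^T *m invmx h *m J.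
have /submxP[D QD] : (Q <= orthogonal_space g J)%MS.
  apply/sub_kermxP; rewrite /Q mulmxBl mul1mx -!(mulmxA _ J) (mulmxA J) -hE.
  by rewrite mulmxKV// subrr.
have : b *m Q^T = 0 by rewrite QD trmx_mul mulmxA b0 mul0mx.
rewrite /Q linearB /= trmx1 !trmx_mul trmxK sg (invmx_sym sh) mulmxBr mulmx1 !mulmxA.
by move/eqP; rewrite subr_eq0 tangential_lift.unlock !mulmxA => /eqP.
Qed.

Lemma proj_annihilator (w : 'rV[R]_m) :
  w *m proj_mx (annihilator J) (annihilator (orthogonal_space g J))
  = w *m (1%:M - J^T *m P).
Proof.
have cap0 : (annihilator J :&: annihilator (orthogonal_space g J) = 0)%MS.
  set C := (_ :&: _)%MS; have : (C <= C)%MS by [].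
  rewrite {2}/C sub_capmx => /andP[/annihilatorP C0 /orthogonal_annihilatorP ->].
  by rewrite C0 mul0mx.
have {1}-> : w = w *m (1%:M - J^T *m P) + w *m J^T *m P.
  by rewrite mulmxBr mulmx1 mulmxA subrK.
rewrite mulmxDl proj_mx_id//; last first.
  apply/annihilatorP; rewrite mulmxBr mulmx1 mulmxBl -!mulmxA tangential_liftK.
  by rewrite mulmx1 subrr.
rewrite proj_mx_0// ?addr0//; apply/orthogonal_annihilatorP.
by rewrite -(mulmxA (w *m J^T)) tangential_liftK mulmx1.
Qed.

End TangentialLift.

(** P K = h^-1 J and P K~ = h~^-1 J with the same P, hence P K_l = (h_l)^-1 J. *)
Lemma pencil_restrict {R : realType} {m n} (J : 'M[R]_(n, m)) (g gt : 'M[R]_m)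
    (h ht : 'M[R]_n) l :
  g^T = g -> gt^T = gt -> g \in unitmx -> gt \in unitmx ->
  h \in unitmx -> ht \in unitmx ->
  h = J *m g *m J^T -> ht = J *m gt *m J^T -> (J *m (g *m invmx gt) <= J)%MS ->
  let k := invmx g + l *: invmx gt in let kn := invmx h + l *: invmx ht in
  k \in unitmx -> kn \in unitmx ->
  invmx kn = J *m invmx k *m J^T /\
  tangential_lift (invmx k) (invmx kn) J = tangential_lift g h J.
Proof.
move=> sg sgt ug ugt uh uht hE htE dist k kn uk ukn.
have PE := tangential_lift_eq ugt uh uht hE htE dist.
set P := tangential_lift g h J in PE *.
have Pk : P *m k = kn *m J.
  rewrite /k mulmxDr (tangential_liftV _ _ ug) -scalemxAr -PE (tangential_liftV _ _ ugt).
  by rewrite mulmxDl -scalemxAl.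
have P2 : kn *m J *m invmx k = P by rewrite -Pk mulmxK.
split; last by rewrite tangential_lift.unlock invmxK.
rewrite -[RHS](mulKmx ukn) (mulmxA kn) (mulmxA kn) P2 /P.
by rewrite (tangential_liftK uh hE) mulmx1.
Qed.

Section Immersion.
Context {R : realType} {m n : nat}.
Variables (V : set 'rV[R]_n) (F : 'rV[R]_n -> 'rV[R]_m).
Hypotheses (oV : open V) (sF : smooth_on V F).

Lemma jacobianE z i j : V z -> 'J F z i j = 'D_(delta_mx 0 i) F z 0 j.
Proof.
move=> Vz; have [dF _] := sF 1%N.
by rewrite (deriveEjacobian _ (dF z Vz)) -rowE [RHS]mxE.
Qed.

Lemma differentiable_jacobian z : V z -> differentiable (jacobian F) z.
Proof.
move=> Vz; apply/differentiable_mxP => i j.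
have E : \near z, 'D_(delta_mx 0 i) F z 0 j = 'J F z i j.
  by apply: (open_near oV Vz) => y Vy; rewrite jacobianE.
apply: near_differentiable E _.
have [_ /(_ (delta_mx 0 i))[+ _]] := sF 2%N.
by move=> /(_ z Vz) /differentiable_mxP; exact.
Qed.

Lemma hessianE z u v : V z -> v *m 'D_u (jacobian F) z = 'D_u ('D_v F) z.
Proof.
move=> Vz; rewrite -derive_mulmxl; last exact: differentiable_jacobian.
apply: near_eq_derive; apply: (open_near oV Vz) => y Vy.
by have [dF _] := sF 1%N; rewrite deriveEjacobian//; exact: dF.
Qed.

Lemma hessianC z u v : V z ->
  v *m 'D_u (jacobian F) z = u *m 'D_v (jacobian F) z.
Proof.
move=> Vz; apply: etrans (hessianE u v Vz) _.
exact: etrans (derive_comm_mx v u oV (sF 2%N) Vz) (esym (hessianE v u Vz)).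
Qed.

Variables (G : 'rV[R]_m -> 'M[R]_m) (H : 'rV[R]_n -> 'M[R]_n) (y : 'rV[R]_n).
Hypotheses (Vy : V y) (mG : metric_at G (F y)) (mH : metric_at H y).
Hypothesis HE : forall z, V z -> H z = 'J F z *m G (F z) *m ('J F z)^T.

Local Notation J := ('J F y).

Lemma derive_gram u : 'D_u H y =
  'D_u (jacobian F) y *m G (F y) *m J^T + J *m 'D_(u *m J) G (F y) *m J^T
  + J *m G (F y) *m ('D_u (jacobian F) y)^T.
Proof.
have dJ := differentiable_jacobian Vy; have [dG _ _] := mG.
have [dF _] := sF 1%N; have dFy := dF y Vy.
have dGF : differentiable (G \o F) y by exact: differentiable_comp.
have E : \near y, H y = 'J F y *m (G \o F) y *m ('J F y)^T.
  exact: open_near oV Vy HE.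
rewrite (near_eq_derive u E).
rewrite (derive_mulmx _ (differentiable_mulmx dJ dGF) (differentiable_trmx dJ)).
rewrite (derive_mulmx _ dJ dGF) (derive_trmx _ dJ) (derive_comp _ dFy dG).
by rewrite mulmxDl (deriveEjacobian u dFy).
Qed.

Local Notation P := (tangential_lift (G (F y)) (H y) J).

(** The last term depends on the metric through P alone, which is what makes it
    drop out of differences and split along pencils. *)
Lemma gamma_restrict u a :
  gamma H y u a = gamma G (F y) (u *m J) (a *m P) *m J^T
                  + a *m P *m ('D_u (jacobian F) y)^T.
Proof.
have [dG /nbhs_singleton sGy /nbhs_singleton uGy] := mG; have [dH _ _] := mH.
apply: dot_ext => v; rewrite (gamma_koszul u a v dH).
have -> : (fun u => 'D_u H y) = fun u =>
  'D_u (jacobian F) y *m G (F y) *m J^T + J *m 'D_(u *m J) G (F y) *m J^T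
  + J *m G (F y) *m ('D_u (jacobian F) y)^T.
  by apply/funext => z; exact: derive_gram.
apply: (etrans (@koszul_restrict _ _ _ (fun w => 'D_w G (F y))
  (fun u => 'D_u (jacobian F) y) _ _ _ _ _ sGy (fun u v => hessianC u v Vy))).
rewrite dotDl (dot_mulmx J^T) trmxK (gamma_koszul _ _ _ dG).
have -> : a *m P *m invmx (G (F y)) = a *m invmx (H y) *m J.
  by rewrite tangential_lift.unlock !mulmxA mulmxK.
congr (_ + _); rewrite (dot_mulmx_sym _ _ sGy) dotC (dot_mulmx _ _ v) trmxK.
by rewrite tangential_lift.unlock !mulmxA.
Qed.

End Immersion.

(** * Pencils of metrics on a submanifold *)

Section ImmersedPencil.
Context {R : realType} {m n : nat}.
Variables (V : set 'rV[R]_n) (F : 'rV[R]_n -> 'rV[R]_m).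
Hypotheses (oV : open V) (sF : smooth_on V F).
Variables (G Gt : 'rV[R]_m -> 'M[R]_m) (H Ht : 'rV[R]_n -> 'M[R]_n).
Hypothesis mG : forall z, V z -> metric_at G (F z).
Hypothesis mGt : forall z, V z -> metric_at Gt (F z).
Hypothesis mH : forall z, V z -> metric_at H z.
Hypothesis mHt : forall z, V z -> metric_at Ht z.
Hypothesis uK : forall l z, V z ->
  \forall x \near F z, copencil G Gt l x \in unitmx.
Hypothesis uKN : forall l z, V z -> \near z, copencil H Ht l z \in unitmx.
Hypothesis HE : forall z, V z -> H z = 'J F z *m G (F z) *m ('J F z)^T.
Hypothesis HtE : forall z, V z -> Ht z = 'J F z *m Gt (F z) *m ('J F z)^T.
Hypothesis dist : forall z, V z ->
  ('J F z *m (G (F z) *m invmx (Gt (F z))) <= 'J F z)%MS.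

Local Notation J := (jacobian F).
Local Notation P z := (tangential_lift (G (F z)) (H z) ('J F z)).

Lemma tangential_lift_tilde z : V z ->
  tangential_lift (Gt (F z)) (Ht z) ('J F z) = P z.
Proof.
move=> Vz; have [_ _ /nbhs_singleton ut] := mGt Vz.
have [_ _ /nbhs_singleton uh] := mH Vz; have [_ _ /nbhs_singleton uht] := mHt Vz.
exact: tangential_lift_eq ut uh uht (HE Vz) (HtE Vz) (dist Vz).
Qed.

Lemma pencil_immersed l z : V z ->
  pencil H Ht l z = 'J F z *m pencil G Gt l (F z) *m ('J F z)^T /\
  tangential_lift (pencil G Gt l (F z)) (pencil H Ht l z) ('J F z) = P z.
Proof.
move=> Vz; have [_ /nbhs_singleton sg /nbhs_singleton ug] := mG Vz.
have [_ /nbhs_singleton sgt /nbhs_singleton ugt] := mGt Vz.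
have [_ _ /nbhs_singleton uh] := mH Vz; have [_ _ /nbhs_singleton uht] := mHt Vz.
exact: pencil_restrict sg sgt ug ugt uh uht (HE Vz) (HtE Vz) (dist Vz)
  (nbhs_singleton (uK l Vz)) (nbhs_singleton (uKN l Vz)).
Qed.

Variables (y : 'rV[R]_n) (Vy : V y).

Lemma diffconn_restrict u a : diffconn H Ht y u a =
  diffconn G Gt (F y) (u *m J y) (a *m P y) *m (J y)^T.
Proof.
have E1 := gamma_restrict oV sF Vy (mG Vy) (mH Vy) HE u a.
have E2 := gamma_restrict oV sF Vy (mGt Vy) (mHt Vy) HtE u a.
rewrite (tangential_lift_tilde Vy) in E2.
rewrite /diffconn E1 E2; generalize (gamma G (F y) (u *m J y) (a *m P y))
  (gamma Gt (F y) (u *m J y) (a *m P y)) => c ct.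
by rewrite opprD addrACA subrr addr0 mulmxBl.
Qed.

Lemma almost_compatible_restrict :
  almost_compatible_at G Gt (F y) -> almost_compatible_at H Ht y.
Proof.
move=> ac l u a.
have mP := pencil_metric_at (mG Vy) (mGt Vy) (uK l Vy).
have mPN := pencil_metric_at (mH Vy) (mHt Vy) (uKN l Vy).
have E := gamma_restrict oV sF Vy (mG Vy) (mH Vy) HE u a.
have Et := gamma_restrict oV sF Vy (mGt Vy) (mHt Vy) HtE u a.
have El := gamma_restrict oV sF Vy mP mPN (fun z Vz => (pencil_immersed l Vz).1) u a.
rewrite (tangential_lift_tilde Vy) in Et.
rewrite (pencil_immersed l Vy).2 in El.
have K : invmx (G (F y)) *m (P y)^T = (J y)^T *m invmx (H y).
  have [_ /nbhs_singleton sg /nbhs_singleton ug] := mG Vy.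
  have [_ _ /nbhs_singleton uh] := mH Vy.
  exact: tangential_liftV_tr sg ug (HE Vy).
have Kt : invmx (Gt (F y)) *m (P y)^T = (J y)^T *m invmx (Ht y).
  have [_ /nbhs_singleton sg /nbhs_singleton ug] := mGt Vy.
  rewrite -(tangential_lift_tilde Vy).
  exact: tangential_liftV_tr sg ug (HtE Vy).
have Kl : copencil G Gt l (F y) *m (P y)^T = (J y)^T *m copencil H Ht l y.
  by rewrite /copencil mulmxDl mulmxDr -scalemxAl -scalemxAr K Kt.
have acl := ac l (u *m J y) (a *m P y); move: E Et El acl.
generalize (gamma G (F y) (u *m J y) (a *m P y))
  (gamma Gt (F y) (u *m J y) (a *m P y))
  (gamma (pencil G Gt l) (F y) (u *m J y) (a *m P y)) => c ct cl.
generalize (gamma H y u a) (gamma Ht y u a) (gamma (pencil H Ht l) y u a).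
move=> _ _ _ -> -> -> acl.
rewrite !mulmxDl -!(mulmxA _ (J y)^T) -K -Kt -Kl !mulmxA acl.
rewrite mulmxDl -scalemxAl /copencil mulmxDr -scalemxAr scalerDr.
by rewrite addrACA.
Qed.

Lemma second_form_restrict u a :
  second_form Gt F u a y - second_form G F u a y
  = diffconn G Gt (F y) (u *m J y) (a y) *m (1%:M - (J y)^T *m P y).
Proof.
have [_ /nbhs_singleton sg /nbhs_singleton ug] := mG Vy.
have [_ /nbhs_singleton sgt /nbhs_singleton ugt] := mGt Vy.
have [_ _ /nbhs_singleton uh] := mH Vy; have [_ _ /nbhs_singleton uht] := mHt Vy.
have E : second_form G F u a y = nabla_along G F u a y *m _ :=
  proj_annihilator sg uh (HE Vy) _.
have Et : second_form Gt F u a y = nabla_along Gt F u a y *m _ :=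
  proj_annihilator sgt uht (HtE Vy) _.
rewrite (tangential_lift_tilde Vy) in Et.
apply: (etrans (congr2 (fun p q => p - q) Et E)).
rewrite -mulmxBl /nabla_along /diffconn.
generalize (gamma G (F y) (u *m J y) (a y)) (gamma Gt (F y) (u *m J y) (a y)).
by move=> c ct; rewrite opprB [X in X *m _]addrC addrA subrK.
Qed.

Local Notation normal_diff u a :=
  (diffconn G Gt (F y) (u *m J y) (a *m P y) *m (1%:M - (J y)^T *m P y)).

(** Both sides of the identity on M, for lifted covectors and vectors tangent to N,
    split orthogonally into a term on N and a normal term. *)
Lemma diffconn_symmetric_restrict : diffconn_symmetric G Gt (F y) ->
  (diffconn_symmetric H Ht y <-> forall u v a b,
    dot (normal_diff u a *m invmx (Gt (F y))) (normal_diff v b) =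
    dot (normal_diff v a *m invmx (Gt (F y))) (normal_diff u b)).
Proof.
have [_ /nbhs_singleton sg /nbhs_singleton ug] := mGt Vy.
have [_ _ /nbhs_singleton uh] := mHt Vy.
move=> Q.
have D u v a b : dot (diffconn H Ht y u a *m invmx (Ht y)) (diffconn H Ht y v b)
    + dot (normal_diff u a *m invmx (Gt (F y))) (normal_diff v b)
  = dot (diffconn H Ht y v a *m invmx (Ht y)) (diffconn H Ht y u b)
    + dot (normal_diff v a *m invmx (Gt (F y))) (normal_diff u b).
  rewrite !diffconn_restrict -(tangential_lift_tilde Vy).
  have dec := dot_orthogonal_decomposition sg ug uh (HtE Vy).
  by rewrite -!dec.
by split=> E u v a b; have := D u v a b; rewrite E; [move/addrI|move/addIr].
Qed.

End ImmersedPencil.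

(** * The submanifold in charts *)

Section SubmanifoldCharts.
Context {R : realType} {m n : nat} {M : manifold R m} {N : manifold R n}.
Variable f : N -> M.
Hypothesis f_sub : submanifold f.

Lemma local_dom_sub (j : chart N) (i : chart M) : local_dom f j i `<=` chart_image j.
Proof. by move=> _ [p [jp _] <-]; exists p. Qed.

Lemma local_map_image (j : chart N) (i : chart M) y :
  local_dom f j i y -> chart_image i (local_map f j i y).
Proof. by move=> [p [jp ip] <-]; exists (f p); rewrite // /local_map /= coordK. Qed.

Lemma open_local_dom (j : chart N) (i : chart M) : open (local_dom f j i).
Proof.
case: f_sub => _ cf _ _; rewrite openE => _ [p [jp ip] <-]; rewrite /interior.
have pc := param_continuous jp.
have fi : nbhs (chart_param j (chart_coord j p)) (f @^-1` chart_dom i).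
  rewrite coordK//; apply: cf; apply: open_nbhs_nbhs; split=> //; exact: dom_open.
have ji : nbhs (chart_coord j p) (chart_image j).
  by apply: open_nbhs_nbhs; split; [exact: open_chart_image|exists p].
apply: filterS2 ji (pc _ fi) => _ [q jq <-] /=; rewrite coordK// => iq.
by exists q.
Qed.

End SubmanifoldCharts.

Lemma cometricE {R : realType} {m} (g : 'M[R]_m) a b :
  cometric g a b = dot (a *m invmx g) b.
Proof. by rewrite dot.unlock. Qed.

(** For constant w these sections take all values of (TN^perp)^0 at a given
    point, so the identity on sections yields the identity on covectors. *)
Lemma smooth_tangential {R : realType} {m n} (V : set 'rV[R]_n) (U : set 'rV[R]_m)
    (F : 'rV[R]_n -> 'rV[R]_m) (G : 'rV[R]_m -> 'M[R]_m) (w : 'rV[R]_n) :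
  open V -> open U -> (forall z, V z -> U (F z)) -> smooth_on V F -> smooth_on U G ->
  smooth_on V (fun z => w *m 'J F z *m G (F z)).
Proof.
move=> oV oU VU sF sG k; have [dF cF] := sF k.+1.
apply: (Ck_ext oV _ (Ck_mulmx oV (cF w) (Ck_comp oV oU VU (sF k) (sG k)))).
by move=> z Vz; rewrite (deriveEjacobian w (dF z Vz)).
Qed.

Theorem proposition27 (R : realType) (m n : nat)
    (M : manifold R m) (N : manifold R n)
    (g gt : metric M) (h ht : metric N) (f : N -> M)
    (g_pencil : pencil_nondegenerate g gt)
    (g_compatible : compatible g gt)
    (f_submanifold : submanifold f)
    (f_distinguished : distinguished f g gt)
    (h_induced : induced_metric f g h)
    (ht_induced : induced_metric f gt ht)
    (h_pencil : pencil_nondegenerate h ht) :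
  compatible h ht <->
  (forall (j : chart N) (i : chart M) (U : set 'rV[R]_n),
     open U -> U `<=` local_dom f j i ->
   forall a b : 'rV[R]_n -> 'rV[R]_m,
     tangential_form f g j i U a -> tangential_form f g j i U b ->
   forall (u v y : 'rV[R]_n), U y ->
     cometric (gt i (local_map f j i y))
       (second_form_diff f g gt j i u a y) (second_form_diff f g gt j i v b y)
     = cometric (gt i (local_map f j i y))
       (second_form_diff f g gt j i v a y)
       (second_form_diff f g gt j i u b y)).
Proof.
have gP := (compatibleP g_pencil).1 g_compatible.
have oV j i : open (local_dom f j i) by exact: open_local_dom.
have sF j i : smooth_on (local_dom f j i) (local_map f j i).
  by case: f_submanifold => _ _ + _; exact.
have mM (k : metric M) j i z : local_dom f j i z -> metric_at (k i) (local_map f j i z).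
  by move=> /local_map_image; exact: metric_at_gram.
have mN (k : metric N) j i z : local_dom f j i z -> metric_at (k j) z.
  by move=> /local_dom_sub; exact: metric_at_gram.
have uM j i l z : local_dom f j i z ->
    \forall x \near local_map f j i z, copencil (g i) (gt i) l x \in unitmx.
  by move=> /local_map_image; exact: copencil_near.
have uN j i l z : local_dom f j i z -> \near z, copencil (h j) (ht j) l z \in unitmx.
  by move=> /local_dom_sub; exact: copencil_near.
have dist j i z : local_dom f j i z -> stablemx ('J (local_map f j i) z)
    (g i (local_map f j i z) *m invmx (gt i (local_map f j i z))).
  exact: f_distinguished.
pose gM j i y (Vy : local_dom f j i y) := gP i _ (local_map_image Vy).
have AC j i y (Vy : local_dom f j i y) : almost_compatible_at (h j) (ht j) y :=
  almost_compatible_restrict (oV j i) (sF j i) (mM g j i) (mM gt j i) (mN h j i)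
    (mN ht j i) (uM j i) (uN j i) (h_induced j i) (ht_induced j i) (dist j i) Vy
    (gM j i y Vy).1.
have SD j i y (Vy : local_dom f j i y) u a :=
  second_form_restrict (mM g j i) (mM gt j i) (mN h j i)
    (mN ht j i) (h_induced j i) (ht_induced j i) (dist j i) Vy u a.
have QP j i y (Vy : local_dom f j i y) :=
  diffconn_symmetric_restrict (oV j i) (sF j i) (mM g j i) (mM gt j i) (mN h j i)
    (mN ht j i) (h_induced j i) (ht_induced j i) (dist j i) Vy
    (gM j i y Vy).2.
have TP j i y (Vy : local_dom f j i y) (b : 'rV[R]_m) :
    (b <= TNperp0 (g i) (local_map f j i) y)%MS <->
    b = b *m ('J (local_map f j i) y)^T *m tangential_lift (g i (local_map f j i y)) (h j y)
         ('J (local_map f j i) y).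
  have [_ /nbhs_singleton sg _] := mM g j i y Vy.
  have [_ _ /nbhs_singleton uh] := mN h j i y Vy.
  exact: orthogonal_annihilatorP sg uh (h_induced j i y Vy) _ b.
split=> [/(compatibleP h_pencil) hP j i U oU UV a b [sa ta] [sb tb] u v y Uy|E].
  have Vy := UV y Uy.
  have Q := (QP j i y Vy).1 (hP j y (local_dom_sub Vy)).2 u v
    (a y *m ('J (local_map f j i) y)^T) (b y *m ('J (local_map f j i) y)^T).
  rewrite -((TP j i y Vy (a y)).1 (ta y Uy)) -((TP j i y Vy (b y)).1 (tb y Uy)) in Q.
  by rewrite !cometricE /second_form_diff !(SD j i y Vy).
apply/(compatibleP h_pencil) => j x jx.
have [p jp px] := jx; have [i ip] := dom_cover (f p).
have Vx : local_dom f j i x by exists p.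
split; first exact: AC Vx.
apply/(QP j i x Vx) => u v a b.
(* A section with value the lift of c at x. *)
pose A (c : 'rV[R]_n) z := c *m invmx (h j x) *m 'J (local_map f j i) z
  *m g i (local_map f j i z).
have tA c : tangential_form f g j i (local_dom f j i) (A c).
  split=> [|z Vz].
    apply: smooth_tangential (oV j i) (open_chart_image i) _ (sF j i) (gram_smooth g i).
    by move=> z; exact: local_map_image.
  apply/(TP j i z Vz).
  have [_ _ /nbhs_singleton uh] := mN h j i z Vz.
  rewrite /A -!(mulmxA (c *m _)) -(h_induced j i z Vz).
  by rewrite tangential_lift.unlock !mulmxA mulmxK.
have := E j i _ (oV j i) (@subset_refl _ _) _ _ (tA a) (tA b) u v x Vx.
rewrite !cometricE /second_form_diff !(SD j i x Vx).
have AE c : A c x = c *m tangential_lift (g i (local_map f j i x)) (h j x)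
    ('J (local_map f j i) x) by rewrite tangential_lift.unlock /A !mulmxA.
by rewrite !AE.
Qed.
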